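(* For any square-free positive integer $N$, the group $\Gamma_0(N)^+$ has no residual eigenvalues $\lambda\in[0,1/4)$ besides the obvious one $\lambda_0=0$.
   Context: For a square-free positive integer $N$, $$\Gamma_0(N)^+=\left\{ e^{-1/2}\begin{pmatrix} a & b\\ c& d\end{pmatrix}\in \mathrm{SL}(2,\mathbb{R}):\ ad-bc=e,\ a,b,c,d,e\in\mathbb{Z},\ e\mid N,\ e\mid a,\ e\mid d,\ N\mid c\right\}$$ (with $e>0$), acting on the upper half plane $\mathbb{H}$; the quotient has exactly one cusp, at $i\infty$, with stabilizer $\Gamma_\infty(N)$. The real analytic Eisenstein series is $\mathcal{E}_\infty(z,s)=\sum_{\gamma\in\Gamma_\infty(N)\backslash\Gamma_0(N)^+}\mathrm{Im}(\gamma z)^s$ for $\mathrm{Re}(s)>1$, and is meromorphically continued to $s\in\mathbb{C}$. Residual eigenvalues are the eigenvalues of the hyperbolic Laplacian on $\Gamma_0(N)^+\backslash\mathbb{H}$ belonging to the residual spectrum, i.e. the numbers $\lambda=s(1-s)$ where $s\in(1/2,1]$ is a pole of the meromorphically continued Eisenstein series $\mathcal{E}_\infty(z,s)$; $\lambda_0=0$ corresponds to the pole at $s=1$. *)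

(* Defs.v *)
From HB Require Import structures.
From mathcomp Require Import all_boot all_order all_algebra.
From mathcomp Require Import complex.
From mathcomp Require Import all_classical all_reals all_analysis.
From mathcomp.analysis.showcase Require summability.
Set Implicit Arguments.
Unset Strict Implicit.
Unset Printing Implicit Defensive.
Import Order.TTheory GRing.Theory Num.Theory.
Import numFieldNormedType.Exports.
Local Open Scope classical_set_scope.
Local Open Scope ring_scope.
Local Open Scope complex_scope.

Definition squarefree (n : nat) : Prop :=
  forall d : nat, (d ^ 2 %| n)%N -> d = 1%N.

(* The regular module R[i]^o carries the usual topology of the complex plane. *)
Section Meromorphic.
Context {R : realType}.
Implicit Types (f : R[i] -> R[i]) (w : R[i]).

Definition analytic_at f w : Prop :=
  exists a : nat -> R[i], \forall s \near (w : R[i]^o),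
    series (fun n => a n * (s - w) ^+ n : R[i]^o) @ \oo --> (f s : R[i]^o).

(* The value of f at w itself is irrelevant in the next two definitions. *)
Definition meromorphic_at f w : Prop :=
  exists (k : nat) (g : R[i] -> R[i]), analytic_at g w /\
    \forall s \near (w : R[i]^o)^', f s = g s / (s - w) ^+ k.

Definition pole_at f w : Prop :=
  exists (k : nat) (g : R[i] -> R[i]),
    [/\ analytic_at g w, g w != 0 &
        \forall s \near (w : R[i]^o)^', f s = g s / (s - w) ^+ k.+1].

(* y ^ s = exp (s * ln y), for y > 0 *)
Definition cpow (y : R) (s : R[i]) : R[i] :=
  (expR (complex.Re s * ln y) * cos (complex.Im s * ln y)) +i*
  (expR (complex.Re s * ln y) * sin (complex.Im s * ln y)).

End Meromorphic.

Section Group.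
Variables (R : realType) (N : nat).

Definition mx22 (a b c d : R) : 'M[R]_2 :=
  \matrix_(i, j) if i == 0 then if j == 0 then a else b
                 else if j == 0 then c else d.

Definition Gamma0plus : set 'M[R]_2 :=
  [set g | exists a b c d e : int,
    [/\ 0 < e, a * d - b * c = e, (e %| N%:Z)%Z,
        [/\ (e %| a)%Z, (e %| d)%Z & (N%:Z %| c)%Z] &
        g = (Num.sqrt (e%:~R : R))^-1 *:
            mx22 a%:~R b%:~R c%:~R d%:~R]].

(* A matrix of SL(2, R) fixes the point at infinity iff its lower left entry
   vanishes. *)
Definition Gamma_inf : set 'M[R]_2 := [set g | Gamma0plus g /\ g 1 0 = 0].

Definition cosets : set (set 'M[R]_2) :=
  [set [set h *m g | h in Gamma_inf] | g in Gamma0plus].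

Definition coset_repr (c : set 'M[R]_2) : 'M[R]_2 := xget 1%:M c.

Definition moebius (g : 'M[R]_2) (z : R[i]) : R[i] :=
  ((g 0 0)%:C * z + (g 0 1)%:C) / ((g 1 0)%:C * z + (g 1 1)%:C).

(* The sum is unordered, i.e. a limit along the finite sets of cosets.  Since
   the imaginary part of g z depends only on the coset of g, the choice of
   representatives is immaterial. *)
Definition eisenstein (z s : R[i]) : R[i] :=
  summability.sum (fun c : cosets =>
    cpow (complex.Im (moebius (coset_repr (val c)) z)) s : R[i]^o).

Definition eisenstein_continuation (E : R[i] -> R[i] -> R[i]) : Prop :=
  forall z, 0 < complex.Im z ->
    (forall w, meromorphic_at (E z) w) /\
    (forall s, 1 < complex.Re s -> E z s = eisenstein z s).

End Group.

Definition residual_eigenvalue (R : realType) (E : R[i] -> R[i] -> R[i])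
    (lambda : R) : Prop :=
  exists s : R, [/\ 2^-1 < s, s <= 1, lambda = s * (1 - s) &
    exists2 z, 0 < complex.Im z & pole_at (E z) s%:C].

(* Main.v *)
Require Import Defs.
From mathcomp Require Import all_boot all_order all_algebra.
From mathcomp Require Import complex.
From mathcomp Require Import finmap.
From mathcomp Require Import all_classical all_reals all_analysis.
From mathcomp.analysis.showcase Require summability.
From mathcomp Require Import lra zify ring.
Set Implicit Arguments.
Unset Strict Implicit.
Unset Printing Implicit Defensive.
Import Order.TTheory GRing.Theory Num.Theory.
Import numFieldNormedType.Exports.
Import summability.
Local Open Scope classical_set_scope.
Local Open Scope ring_scope.
Local Open Scope complex_scope.

(** Put y = Im z and, for f | N and an integer vector (m, n), let
    q(f, (m, n)) = lam * |f m z + n|^2 / f, where the constant lam > 0 is so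
    large that q(f, v) >= max(|m|, |n|)^2.

    Arithmetic.  The bottom row of an element of the group is
    sqrt(N/f) * (f c, d) with f | N and (N/f) d prime to f c; it determines the
    coset and is determined by it up to sign, and Im(g z) = (lam y / N) / q(f, (c, d)).  As N is
    square-free, every (f', v) with f' | N and v <> 0 arises exactly once from
    a coset, a sign, an integer k >= 1 and a divisor w of N: remove the content
    k of v, then the common factors of its coordinates with N/f' and f', whose
    product is w.  Under this correspondence q gets multiplied by k^2 w.
    Hence, for real s > 1 (unfold_sum),

      sum_(f, v) q(f, v)^(-s) = 2 (lam y / N)^(-s) Z(s) E(z, s),
      where Z(s) = sum_(k >= 1, w | N) (k^2 w)^(-s).

    Continuation.  Since q(f, 2v) = 4 q(f, v) and every even vector is the
    rounding 2 floor(v/2) of exactly four vectors v,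

      (1 - 4^(1-s)) sum_(f, v) q(f, v)^(-s)
        = sum_(f, v) (q(f, v)^(-s) - q(f, 2 floor(v/2))^(-s)),

    the second power being omitted when floor(v/2) = 0.  The summands on the
    right are O(|v|^(-2s-1)), so that the right-hand side H(s) converges
    absolutely and is real analytic for s > 1/2 (doubling_sum).  With
    P(s) = 2 (lam y / N)^(-s) Z(s) (1 - 4^(1-s)), the identity
    P(s) E(z, s) = H(s) holds for s > 1, hence for all s > 1/2 by the identity
    theorem along the real axis (meromorphic_continuation).  On (1/2, 1) the
    factor P does not vanish, because Z > 0 and 4^(1-s) <> 1; so E(z, .) has no
    pole there (no_pole).

    The pole at 1.  The sum of q(1, v)^(-s) exceeds a multiple of the harmonic
    series in the limit s -> 1+, so it is unbounded (lattice_unbounded), and so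
    is E(z, s); a meromorphic function that is unbounded near a point has a
    pole there (pole_at_one).  Finally lambda = s (1 - s) vanishes at s = 1.

    A residual pole lies on the real axis, so the argument only needs real
    s; the real and imaginary parts of E(z, .) are continued separately,
    as real power series. *)

#[local] Existing Instance totally_filter.

(** * Unordered sums of real families *)

Section HasSum.
Context {R : realType}.

Definition has_sum (I : choiceType) (f : I -> R) (l : R) : Prop :=
  partial_sum f @ totally --> l.

Lemma partial_sumE (V : zmodType) (I : choiceType) (f : I -> V) (A : {fset I}) :
  partial_sum f A = \sum_(i <- A) f i.
Proof. by rewrite /partial_sum big_seq_fsetE. Qed.

Lemma has_sum_unique (I : choiceType) (f : I -> R) l m :
  has_sum f l -> has_sum f m -> l = m.
Proof. by move=> fl gm; apply: (cvg_unique _ fl gm). Qed.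

Lemma eq_has_sum (I : choiceType) (f g : I -> R) l :
  f =1 g -> has_sum f l -> has_sum g l.
Proof. by move=> /funext ->. Qed.

Lemma has_sumD (I : choiceType) (f g : I -> R) l m :
  has_sum f l -> has_sum g m -> has_sum (fun i => f i + g i) (l + m).
Proof.
move=> fl gm; rewrite /has_sum.
have -> : partial_sum (fun i => f i + g i) = partial_sum f \+ partial_sum g.
  by apply/funext => A; rewrite /= !partial_sumE big_split.
exact: cvgD.
Qed.

Lemma has_sumZ (I : choiceType) (f : I -> R) l a :
  has_sum f l -> has_sum (fun i => a * f i) (a * l).
Proof.
move=> fl; rewrite /has_sum.
have -> : partial_sum (fun i => a * f i) = (fun A => a * partial_sum f A).
  by apply/funext => A; rewrite /= !partial_sumE mulr_sumr.
exact: cvgMl_tmp.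
Qed.

Lemma has_sumB (I : choiceType) (f g : I -> R) l m :
  has_sum f l -> has_sum g m -> has_sum (fun i => f i - g i) (l - m).
Proof.
move=> fl /(has_sumZ (a := -1)); rewrite mulN1r => gm.
by apply: eq_has_sum (has_sumD fl gm) => i; rewrite mulN1r.
Qed.

Lemma has_sum0 (I : choiceType) : has_sum (fun _ : I => 0) 0.
Proof.
rewrite /has_sum.
have -> : partial_sum (fun _ : I => 0 : R) = (fun=> 0).
  by apply/funext => A; rewrite /= !partial_sumE big1.
exact: cvg_cst.
Qed.

Lemma has_sum_big (I : choiceType) (f : nat -> I -> R) (l : nat -> R) n :
  (forall k, has_sum (f k) (l k)) ->
  has_sum (fun i => \sum_(k < n) f k i) (\sum_(k < n) l k).
Proof.
move=> fl; elim: n => [|n IH].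
  by rewrite big_ord0; apply: eq_has_sum (has_sum0 I) => i; rewrite big_ord0.
rewrite big_ord_recr; apply: eq_has_sum (has_sumD IH (fl n)) => i.
by rewrite big_ord_recr.
Qed.

Lemma le_has_sum (I : choiceType) (f g : I -> R) l m :
  (forall i, f i <= g i) -> has_sum f l -> has_sum g m -> l <= m.
Proof.
move=> fg fl gm; rewrite -subr_ge0.
have := has_sumB gm fl; rewrite /has_sum => h.
apply: (@closed_cvg _ _ totally _ _ (fun x : R => 0 <= x) _ _ _ h); first exact: closed_ge.
by exists fset0 => // A _ /=; rewrite partial_sumE sumr_ge0// => i _; rewrite subr_ge0.
Qed.

Lemma has_sum_normr_le (I : choiceType) (f b : I -> R) l B :
  (forall i, `|f i| <= b i) -> has_sum f l -> has_sum b B -> `|l| <= B.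
Proof.
move=> fb fl bB; rewrite ler_norml; apply/andP; split.
  rewrite -mulN1r; apply: le_has_sum (has_sumZ (a := -1) bB) fl => i.
  by rewrite mulN1r; have := fb i; rewrite ler_norml => /andP[].
apply: le_has_sum fl bB => i.
by have := fb i; rewrite ler_norml => /andP[].
Qed.

Lemma has_sum_partial_le (I : choiceType) (f : I -> R) l (A : {fset I}) :
  (forall i, 0 <= f i) -> has_sum f l -> \sum_(i <- A) f i <= l.
Proof.
rewrite /has_sum => f0 fl.
apply: (@closed_cvg _ _ totally _ _ (fun x : R => _ <= x) _ _ _ fl); first exact: closed_ge.
exists A => // B /= AB; rewrite partial_sumE.
rewrite [leRHS](big_fsetID _ (mem A)) /=.
rewrite [X in _ <= X + _](_ : _ = \sum_(i <- A) f i); last first.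
  by apply: eq_fbigl => i; rewrite !inE /= andbC; case: (boolP (i \in A)) => // /(fsubsetP AB) ->.
by rewrite lerDl sumr_ge0.
Qed.

(** Partial sums of a nonnegative family increase, so they converge to
    their supremum. *)
Lemma has_sum_bounded (I : choiceType) (f : I -> R) M :
  (forall i, 0 <= f i) -> (forall A : {fset I}, \sum_(i <- A) f i <= M) ->
  exists l, has_sum f l.
Proof.
move=> f0 fM; set S := [set partial_sum f A | A in [set: {fset I}]].
have supS : has_sup S.
  split; first by exists (partial_sum f fset0); exists fset0.
  by exists M => _ [A _ <-]; rewrite partial_sumE.
exists (sup S); apply/cvgrPdist_le => e e0.
have [_ [A _ <-] He] := sup_adherent e0 supS.
exists A => // B /= AB.
have AB' : partial_sum f A <= partial_sum f B.
  rewrite !partial_sumE [leRHS](big_fsetID _ (mem A)) /=.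
  rewrite [X in _ <= X + _](_ : _ = \sum_(i <- A) f i); last first.
    by apply: eq_fbigl => i; rewrite !inE /= andbC; case: (boolP (i \in A)) => // /(fsubsetP AB) ->.
  by rewrite lerDl sumr_ge0.
have Ble : partial_sum f B <= sup S by apply: ub_le_sup; [case: supS|exists B].
by rewrite ger0_norm ?subr_ge0// lerBlDr -lerBlDl (le_trans (ltW He)).
Qed.

(** Adding the dominating family makes f nonnegative; this reduces signed
    families to has_sum_bounded. *)
Lemma has_sum_dominated (I : choiceType) (f b : I -> R) B :
  (forall i, `|f i| <= b i) -> has_sum b B -> exists l, has_sum f l.
Proof.
move=> fb bB.
have b0 i : 0 <= b i by apply: le_trans (fb i).
have fbi i : - b i <= f i <= b i by rewrite -ler_norml.
have [l Hl] : exists l, has_sum (fun i => f i + b i) l.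
  apply: (@has_sum_bounded _ _ (2 * B)).
    by move=> i; have := fbi i; lra.
  move=> A; apply: (@le_trans _ _ (\sum_(i <- A) (2 * b i))).
    by apply: ler_sum => i _; have := fbi i; lra.
  by rewrite -mulr_sumr ler_pM2l// has_sum_partial_le.
exists (l - B); apply: eq_has_sum (has_sumB Hl bB) => i.
by rewrite addrK.
Qed.

(** For nonnegative families the limit is an extended-real sum, which gives
    access to reindexing and to iterated sums. *)
Lemma has_sum_esum (I : choiceType) (f : I -> R) l :
  (forall i, 0 <= f i) ->
  has_sum f l <-> \esum_(i in [set: I]) (f i)%:E = l%:E.
Proof.
move=> f0.
have E1 m : has_sum f m -> \esum_(i in [set: I]) (f i)%:E = m%:E.
  move=> fm; apply/eqP; rewrite eq_le; apply/andP; split.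
    apply: ge_ereal_sup => _ [A [finA _] <-].
    rewrite fsbig_finite// sumEFin lee_fin.
    exact: has_sum_partial_le.
  apply/lee_addgt0Pr => e e0.
  move/cvgrPdist_le : fm => /(_ _ e0)[A _ /(_ A)] /=.
  rewrite fsubset_refl => /(_ isT) mA.
  apply: (@le_trans _ _ ((\sum_(i <- A) f i)%:E + e%:E)%E).
    rewrite -EFinD lee_fin; rewrite partial_sumE in mA.
    by have := le_trans (ler_norm _) mA; lra.
  rewrite leeD2r//; apply: esum_ge; exists [set` A]; first by split.
  by rewrite fsbig_finite// set_fsetK sumEFin.
split; first exact: E1.
move=> El.
have [m fm] : exists m, has_sum f m.
  apply: (@has_sum_bounded _ _ l) => // A.
  rewrite -lee_fin -El; apply: esum_ge; exists [set` A]; first by split.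
  by rewrite fsbig_finite// set_fsetK sumEFin.
by have := E1 m fm; rewrite El => -[->].
Qed.

(** The set D lets phi be a total function: it discards the indices that do
    not encode anything. *)
Lemma has_sum_reindex (I J : choiceType) (D : pred I) (phi : I -> J)
    (f : J -> R) (g : I -> R) l :
  {in D &, injective phi} -> (forall j, 0 <= f j) ->
  (forall j, f j != 0 -> exists2 i, D i & phi i = j) ->
  (forall i, g i = if D i then f (phi i) else 0) ->
  has_sum f l <-> has_sum g l.
Proof.
move=> phiI f0 fsupp gE.
rewrite !has_sum_esum//; last by move=> i; rewrite gE; case: ifP.
have -> : \esum_(j in [set: J]) (f j)%:E = \esum_(i in [set: I]) (g i)%:E.
  pose D' := [set i | D i].
  have -> : \esum_(i in [set: I]) (g i)%:E = \esum_(i in D') (f (phi i))%:E.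
    rewrite [RHS]esum_mkcond; apply: eq_esum => i _; rewrite gE /D'.
    have -> : (i \in D') = D i by apply/idP/idP; rewrite inE.
    by case: ifP.
  rewrite -(@esum_image _ _ _ D' phi (fun j => (f j)%:E)); last first.
    by move=> x y; rewrite !inE => Dx Dy /phiI; apply.
  rewrite [RHS]esum_mkcond; apply: eq_esum => j _.
  case: ifPn => //; rewrite notin_setE => nj.
  have [->//|/fsupp[i Di ij]] := eqVneq (f j) 0.
  by case: nj; exists i.
by [].
Qed.

Lemma has_sum_inj (I J : choiceType) (phi : I -> J) (f : J -> R) l :
  injective phi -> (forall j, 0 <= f j) ->
  (forall j, f j != 0 -> exists i, phi i = j) ->
  has_sum f l <-> has_sum (f \o phi) l.
Proof.
move=> phiI f0 fsupp; apply: (@has_sum_reindex _ _ xpredT phi) => //.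
- by move=> x y _ _ /phiI.
- by move=> j /fsupp[i ij]; exists i.
Qed.

Lemma esumZl (I : choiceType) (f : I -> \bar R) (a : R) :
  (0 <= a)%R -> (forall i, 0 <= f i)%E ->
  \esum_(i in [set: I]) (a%:E * f i)%E = (a%:E * \esum_(i in [set: I]) f i)%E.
Proof.
rewrite le_eqVlt => /predU1P[<-|a0] f0.
  by rewrite mul0e esum1// => i _; rewrite mul0e.
rewrite /esum -ereal_sup_pZl//; congr ereal_sup.
apply/seteqP; split => [_ [A [finA _] <-]|_ [_ [A [finA _] <-] <-]].
  exists (\sum_(x \in A) f x)%E; first by exists A.
  by rewrite !fsbig_finite// ge0_sume_distrr// => i _.
exists A => //; by rewrite !fsbig_finite// ge0_sume_distrr// => i _.
Qed.

Lemma has_sum_prod (I J : choiceType) (f : I -> R) (g : J -> R) l m :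
  (forall i, 0 <= f i) -> (forall j, 0 <= g j) ->
  has_sum f l -> has_sum g m ->
  has_sum (fun p : I * J => f p.1 * g p.2) (l * m).
Proof.
move=> f0 g0; rewrite !has_sum_esum//; last by move=> p; rewrite mulr_ge0.
move=> fl gm.
have m0 : 0 <= m.
  by rewrite -lee_fin -gm; apply: esum_ge0 => j _; rewrite lee_fin.
have -> : [set: I * J] = [set: I] `*`` (fun=> [set: J]) by apply/seteqP; split.
rewrite -(@esum_esum _ _ _ _ _ (fun i j => (f i * g j)%:E)); last first.
  by move=> i j _ _; rewrite lee_fin mulr_ge0.
under eq_esum => i _.
  under eq_esum => j _ do rewrite EFinM.
  rewrite esumZl//.
  rewrite gm muleC.
over.
rewrite esumZl// ?fl//.
by rewrite -EFinM mulrC.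
Qed.

End HasSum.

(** * Real analytic functions and continuation along the real axis *)

Section RealAnalytic.
Context {R : realType}.
Implicit Types (f g h P Q : R -> R) (w : R).

(** The remainder estimate, uniform in n, replaces convergence of the power
    series: it is preserved by products and by dominated sums without any
    rearrangement, and it forces convergence where |t| C < 1. *)
Definition taylor_bound f w (a : nat -> R) (M C : R) : Prop :=
  forall t n, `|t| * C <= 1 ->
    `|f (w + t) - \sum_(k < n) a k * t ^+ k| <= M * (C * `|t|) ^+ n.

Definition real_analytic f w : Prop :=
  exists a M C, 0 < C /\ taylor_bound f w a M C.

Lemma taylor_bound_ge0 f w a M C : taylor_bound f w a M C -> 0 <= M.
Proof.
move=> /(_ 0 0%N); rewrite normr0 mul0r expr0 mulr1 => /(_ ler01).
exact: le_trans.
Qed.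

(** The n-th term is the difference of two consecutive remainders; evaluate
    it at t = 1/C. *)
Lemma taylor_bound_coef f w a M C k : 0 < C -> taylor_bound f w a M C ->
  `|a k| <= (2 * M) * C ^+ k.
Proof.
move=> C0 H.
have nC : `|C^-1| = C^-1 by rewrite gtr0_norm// invr_gt0.
have C1 : `|C^-1| * C <= 1 by rewrite nC mulVf ?gt_eqF.
have H0 := H C^-1 k C1; have H1 := H C^-1 k.+1 C1.
rewrite nC mulfV ?gt_eqF// !expr1n !mulr1 in H0 H1.
rewrite big_ord_recr /= in H1.
set S := \sum_(_ < _) _ in H0 H1.
have : `|a k * C^-1 ^+ k| <= 2 * M.
  have -> : a k * C^-1 ^+ k = (f (w + C^-1) - S) - (f (w + C^-1) - (S + a k * C^-1 ^+ k)) by ring.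
  by apply: (le_trans (ler_normB _ _)); lra.
rewrite normrM normrX nC exprVn.
by rewrite ler_pdivrMr// exprn_gt0.
Qed.

Lemma taylor_bound_weaken f w a M C M' C' : 0 < C -> M <= M' -> C <= C' ->
  taylor_bound f w a M C -> taylor_bound f w a M' C'.
Proof.
move=> C0 MM CC H t n tC.
have M0 := taylor_bound_ge0 H.
apply: (le_trans (H t n _)).
  by apply: le_trans tC; rewrite ler_wpM2l.
have r0 : 0 <= C * `|t| by rewrite mulr_ge0// ltW.
apply: ler_pM => //; first exact: exprn_ge0.
by apply: lerXn2r; rewrite ?nnegrE ?mulr_ge0 ?ler_wpM2r// ltW// (lt_le_trans C0).
Qed.

(** Under |a k| <= B D^k the tail is geometric, with ratio at most 1/2 as
    soon as |t| <= 1 / (2 D). *)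
Lemma taylor_bound_series f w a B D : 0 < D ->
  (forall k, `|a k| <= B * D ^+ k) ->
  (forall t, `|t| * (2 * D) <= 1 ->
     series (fun k => a k * t ^+ k) @ \oo --> f (w + t)) ->
  taylor_bound f w a (2 * B) (2 * D).
Proof.
move=> D0 aB fS t n tD.
set r := D * `|t|.
have r0 : 0 <= r by rewrite mulr_ge0// ltW.
have r1 : 2 * r <= 1 by rewrite /r; lra.
have B0 : 0 <= B by have := aB 0%N; rewrite expr0 mulr1; apply: le_trans.
have atB k : `|a k * t ^+ k| <= B * r ^+ k.
  by rewrite normrM normrX exprMn mulrA ler_wpM2r ?exprn_ge0.
pose S n := \sum_(k < n) a k * t ^+ k.
have SE m : `|S (n + m)%N - S n| + 2 * B * r ^+ (n + m) <= 2 * B * r ^+ n.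
  elim: m => [|m IH]; first by rewrite addn0 subrr normr0 add0r.
  apply: le_trans IH; rewrite addnS {1}/S big_ord_recr /= -/(S _) addrAC.
  apply: (le_trans (lerD (ler_normD _ _) (lexx _))).
  have := atB (n + m)%N.
  have : B * r ^+ (n + m) * (2 * r) <= B * r ^+ (n + m) * 1.
    by rewrite ler_wpM2l// mulr_ge0// exprn_ge0.
  rewrite exprS; lra.
have H : `|f (w + t) - S n| <= 2 * B * r ^+ n.
  have Hc : (fun m => series (fun k => a k * t ^+ k) (m + n)%N - S n) @ \oo --> f (w + t) - S n.
    by apply: cvgB; [rewrite cvg_shiftn; exact: fS|exact: cvg_cst].
  move/cvg_norm in Hc.
  rewrite -(cvg_lim (@Rhausdorff R) Hc); apply: limr_le; first exact: cvgP Hc.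
  apply: nearW => m; rewrite /series /= big_mkord addnC.
  apply: le_trans (SE m).
  by rewrite lerDl !mulr_ge0// exprn_ge0.
apply: (le_trans H); rewrite -(mulrA 2 D) -/r ler_wpM2l ?mulr_ge0//.
by rewrite lerXn2r ?nnegrE//; lra.
Qed.

(** Remainder estimates with common radius and summable constants b add up;
    this is how infinite sums of exponentials are seen to be analytic. *)
Lemma real_analytic_family (I : choiceType) (c : I -> nat -> R)
    (d : I -> R -> R) (b : I -> R) B D (F : R -> R) w :
  0 < D -> has_sum b B -> (forall i k, `|c i k| <= b i * D ^+ k) ->
  (forall i t, `|t| * (2 * D) <= 1 ->
     series (fun k => c i k * t ^+ k) @ \oo --> d i (w + t)) ->
  (forall t, `|t| * (2 * D) <= 1 -> has_sum (d^~ (w + t)) (F (w + t))) ->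
  real_analytic F w.
Proof.
move=> D0 bB cb cd dF.
have [|a Ha] := @choice _ _ (fun k l => has_sum (c^~ k) l).
  move=> k; apply: (@has_sum_dominated _ _ _ (fun i => D ^+ k * b i) (D ^+ k * B)).
    by move=> i; rewrite mulrC.
  exact: has_sumZ.
exists a, (2 * B), (2 * D); split; first by rewrite mulr_gt0.
move=> t n tD.
have Hd i : `|d i (w + t) - \sum_(k < n) c i k * t ^+ k| <=
    (2 * (2 * D * `|t|) ^+ n) * b i.
  have := @taylor_bound_series (d i) w (c i) (b i) D D0 (cb i) (cd i) t n tD.
  by move=> /le_trans; apply; lra.
have HS : has_sum (fun i => d i (w + t) - \sum_(k < n) c i k * t ^+ k)
    (F (w + t) - \sum_(k < n) a k * t ^+ k).
  apply: has_sumB; first exact: dF.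
  apply: (@has_sum_big _ _ (fun k i => c i k * t ^+ k) (fun k => a k * t ^+ k)) => k.
  rewrite mulrC; apply: eq_has_sum (has_sumZ (Ha k)) => i.
  by rewrite mulrC.
have := has_sum_normr_le Hd HS (has_sumZ bB).
by move=> /le_trans; apply; lra.
Qed.

(** With q the partial sums of g, the n-th remainder of the Cauchy product is
    g times the remainder of f plus the sum over i < n of
    a_i t^i (g - q_(n-i)): n + 1 terms of size M^2 (C |t|)^n. *)
Lemma real_analyticM f g w :
  real_analytic f w -> real_analytic g w -> real_analytic (fun s => f s * g s) w.
Proof.
move=> [a [M1 [C1 [C10 Hf]]]] [b [M2 [C2 [C20 Hg]]]].
have M10 := taylor_bound_ge0 Hf; have M20 := taylor_bound_ge0 Hg.
pose C := C1 + C2; pose M := 2 * (M1 + M2).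
have C0 : 0 < C by rewrite addr_gt0.
have {}Hf : taylor_bound f w a (M1 + M2) C.
  by apply: taylor_bound_weaken Hf; rewrite ?lerDl// ltW.
have {}Hg : taylor_bound g w b (M1 + M2) C.
  by apply: taylor_bound_weaken Hg; rewrite ?lerDr// ltW.
have aM k := taylor_bound_coef k C0 Hf.
have M0 : 0 <= M by rewrite /M; lra.
have {}Hf : taylor_bound f w a M C by apply: taylor_bound_weaken Hf; rewrite /M; lra.
have {}Hg : taylor_bound g w b M C by apply: taylor_bound_weaken Hg; rewrite /M; lra.
rewrite -/M in aM.
pose c n := \sum_(i < n.+1) a i * b (n - i)%N.
(* 2 * C absorbs the number n + 1 <= 2^n of terms. *)
exists c, (M * M), (2 * C); split; first by rewrite mulr_gt0.
move=> t n tC.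
set r := C * `|t|.
have r0 : 0 <= r by rewrite mulr_ge0// ltW.
have tC' : `|t| * C <= 1 by have := r0; rewrite /r; lra.
pose q n := \sum_(k < n) b k * t ^+ k.
have cq m : \sum_(k < m) c k * t ^+ k = \sum_(i < m) a i * t ^+ i * q (m - i)%N.
  elim: m => [|m IH]; first by rewrite !big_ord0.
  rewrite big_ord_recr /= IH /c mulr_suml.
  rewrite (_ : \sum_(i < m) _ = \sum_(i < m.+1) a i * t ^+ i * q (m - i)%N); last first.
    by rewrite big_ord_recr /= subnn /q big_ord0 mulr0 addr0.
  rewrite -big_split /=; apply: eq_bigr => i _.
  have im : (i <= m)%N by rewrite -ltnS.
  rewrite subSn// /q big_ord_recr /= -/(q _) mulrDr; congr (_ + _).
  rewrite (_ : t ^+ m = t ^+ i * t ^+ (m - i)); first by ring.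
  by rewrite -exprD subnKC.
have -> : f (w + t) * g (w + t) - \sum_(k < n) c k * t ^+ k =
   g (w + t) * (f (w + t) - \sum_(k < n) a k * t ^+ k)
   + \sum_(i < n) a i * t ^+ i * (g (w + t) - q (n - i)%N).
  rewrite cq.
  under [X in _ = _ + X]eq_bigr do rewrite mulrBr.
  rewrite sumrB -mulr_suml; ring.
apply: (le_trans (ler_normD _ _)).
have H1 : `|g (w + t) * (f (w + t) - \sum_(k < n) a k * t ^+ k)| <= M * M * r ^+ n.
  rewrite normrM -mulrA ler_pM//; last exact: Hf.
  by have := Hg t 0%N tC'; rewrite big_ord0 subr0 expr0 mulr1.
have H2 : `|\sum_(i < n) a i * t ^+ i * (g (w + t) - q (n - i)%N)| <= M * M * r ^+ n *+ n.
  apply: (le_trans (ler_norm_sum _ _ _)).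
  rewrite (_ : _ *+ n = \sum_(i < n) M * M * r ^+ n); last by rewrite sumr_const card_ord.
  apply: ler_sum => i _.
  have im : (i <= n)%N by apply: ltnW.
  have -> : r ^+ n = r ^+ i * r ^+ (n - i) by rewrite -exprD subnKC.
  rewrite normrM.
  rewrite (_ : M * M * _ = (M * r ^+ i) * (M * r ^+ (n - i))); last by ring.
  rewrite ler_pM//; last exact: Hg.
  by rewrite normrM normrX exprMn mulrA ler_wpM2r ?exprn_ge0.
apply: (le_trans (lerD H1 H2)).
rewrite -mulrS -[_ *+ n.+1]mulr_natr.
rewrite (_ : M * M * (2 * C * `|t|) ^+ n = (M * M * r ^+ n) * 2 ^+ n); last first.
  by rewrite /r !exprMn; ring.
apply: ler_wpM2l; first exact: (mulr_ge0 (mulr_ge0 M0 M0) (exprn_ge0 n r0)).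
by rewrite -natrX ler_nat ltn_expl.
Qed.

Lemma real_analytic_cst c w : real_analytic (fun=> c) w.
Proof.
exists (fun k => if k == 0%N then c else 0), `|c|, 1; split => // t n; rewrite mulr1 => t1.
case: n => [|n]; first by rewrite big_ord0 subr0 expr0 mulr1.
rewrite big_ord_recl /= expr0 mulr1 big1 ?addr0 ?subrr ?normr0; last first.
  by move=> i _; rewrite mul0r.
by rewrite mulr_ge0 ?exprn_ge0 ?mulr_ge0.
Qed.

Lemma real_analytic_center w : real_analytic (fun s => s - w) w.
Proof.
exists (fun k => if k == 1%N then 1 else 0), 1, 1; split => // t n; rewrite mulr1 => t1.
rewrite mul1r mul1r (_ : w + t - w = t); last by ring.
case: n => [|[|n]].
- by rewrite big_ord0 subr0 expr0.
- by rewrite big_ord_recl big_ord0 /= mul0r addr0 subr0 expr1.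
- rewrite !big_ord_recl /= mul0r add0r mul1r big1 ?addr0 ?expr1 ?subrr ?normr0//.
  by move=> i _; rewrite mul0r.
Qed.

Lemma real_analyticX f w k : real_analytic f w -> real_analytic (fun s => f s ^+ k) w.
Proof.
move=> Hf; elim: k => [|k IH]; first exact: (real_analytic_cst 1).
rewrite (_ : (fun _ => _) = (fun s => f s * f s ^+ k)); first exact: real_analyticM.
by apply/funext => s; rewrite exprS.
Qed.

Lemma real_analyticB f g w :
  real_analytic f w -> real_analytic g w -> real_analytic (fun s => f s - g s) w.
Proof.
move=> [a [M1 [C1 [C10 Hf]]]] [b [M2 [C2 [C20 Hg]]]].
have M10 := taylor_bound_ge0 Hf; have M20 := taylor_bound_ge0 Hg.
have {}Hf : taylor_bound f w a M1 (C1 + C2).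
  by apply: taylor_bound_weaken Hf; rewrite ?lerDl// ltW.
have {}Hg : taylor_bound g w b M2 (C1 + C2).
  by apply: taylor_bound_weaken Hg; rewrite ?lerDr// ltW.
exists (fun k => a k - b k), (M1 + M2), (C1 + C2); split; first by rewrite addr_gt0.
move=> t n tC; rewrite (_ : _ - _ = (f (w + t) - \sum_(k < n) a k * t ^+ k) -
  (g (w + t) - \sum_(k < n) b k * t ^+ k)); last first.
  under eq_bigr do rewrite mulrBl.
  by rewrite sumrB; ring.
by rewrite mulrDl (le_trans (ler_normB _ _))// lerD// ?Hf ?Hg.
Qed.

Lemma real_analytic_bounded f w : real_analytic f w ->
  exists M r, 0 < r /\ forall t, `|t| <= r -> `|f (w + t)| <= M.
Proof.
move=> [a [M [C [C0 H]]]]; exists M, C^-1; split; first by rewrite invr_gt0.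
move=> t tC; have := H t 0%N; rewrite big_ord0 subr0 expr0 mulr1; apply.
by rewrite -ler_pdivlMr// mul1r.
Qed.

(** If all lower coefficients vanish, then |a n| <= M C^(n+1) |t| at every
    zero w + t, hence a n = 0; once all coefficients vanish, the remainder
    estimate bounds |f| by M (C |t|)^n for every n. *)
Lemma real_analytic_identity f w : real_analytic f w ->
  (forall e, 0 < e -> exists t, 0 < `|t| < e /\ f (w + t) = 0) ->
  exists r, 0 < r /\ forall t, `|t| < r -> f (w + t) = 0.
Proof.
move=> [a [M [C [C0 H]]]] fz.
have M0 := taylor_bound_ge0 H.
have a0 : forall n, a n = 0.
  elim/ltn_ind => n IH; apply/eqP; rewrite -normr_le0; apply/ler_addgt0Pr => e e0.
  have K0 : 0 < M * C ^+ n.+1 + 1 by rewrite ltr_wpDl// mulr_ge0// exprn_ge0// ltW.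
  have [|t [/andP[t0 te] ft]] := fz (Num.min C^-1 (e / (M * C ^+ n.+1 + 1))).
    by rewrite lt_min invr_gt0 C0 divr_gt0.
  move: te; rewrite lt_min => /andP[tC te].
  have := H t n.+1; rewrite ft big_ord_recr /= big1; last first.
    by move=> i _; rewrite IH ?mul0r.
  rewrite -ler_pdivlMr// mul1r => /(_ (ltW tC)).
  rewrite !add0r normrN normrM normrX exprMn mulrA [(`|t| : R) ^+ n.+1]exprS mulrA.
  rewrite ler_pM2r ?exprn_gt0// => /le_trans; apply.
  rewrite ltr_pdivlMr// in te.
  apply: le_trans (ltW te); rewrite mulrDr mulr1 mulrC.
  by rewrite lerDl.
exists (C^-1); split; first by rewrite invr_gt0.
move=> t tC.
have r1 : C * `|t| < 1 by rewrite mulrC -ltr_pdivlMr// mul1r.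
have r0 : 0 <= C * `|t| by rewrite mulr_ge0// ltW.
have Hb n : `|f (w + t)| <= M * (C * `|t|) ^+ n.
  have := H t n; rewrite big1 ?subr0; last by move=> i _; rewrite a0 mul0r.
  by apply; rewrite mulrC ltW.
apply/eqP; rewrite -normr_le0.
have Hl : (fun n => M * (C * `|t|) ^+ n) @ \oo --> M * 0.
  by apply: cvgMl_tmp; apply: cvg_expr; rewrite ger0_norm.
rewrite mulr0 in Hl; rewrite -(cvg_lim (@Rhausdorff R) Hl).
by apply: limr_ge; [exact: cvgP Hl|exact: nearW].
Qed.

Definition real_meromorphic h w : Prop :=
  exists k g e, [/\ real_analytic g w, 0 < e &
    forall t, 0 < `|t| < e -> h (w + t) = g (w + t) / t ^+ k].

(** The point w itself is excluded because meromorphy says nothing about the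
    value there. *)
Definition vanishes_around (D : R -> R) w : Prop :=
  exists e, 0 < e /\ forall t, 0 < `|t| < e -> D (w + t) = 0.

(** Clearing the denominator t^k of h turns P h - Q into an analytic function
    with the same zeros near w. *)
Lemma meromorphic_identity h P Q w :
  real_meromorphic h w -> real_analytic P w -> real_analytic Q w ->
  (forall e, 0 < e -> exists t, 0 < `|t| < e /\ P (w + t) * h (w + t) - Q (w + t) = 0) ->
  vanishes_around (fun s => P s * h s - Q s) w.
Proof.
move=> [k [g [e [ga e0 hg]]]] Pa Qa acc.
pose f s := P s * g s - Q s * (s - w) ^+ k.
have fa : real_analytic f w.
  apply: real_analyticB; apply: real_analyticM => //.
  by apply: real_analyticX; exact: real_analytic_center.
have fD t : 0 < `|t| < e -> f (w + t) = (P (w + t) * h (w + t) - Q (w + t)) * t ^+ k.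
  move=> te; rewrite hg// /f (_ : w + t - w = t); last by ring.
  have : t != 0 by rewrite -normr_gt0; case/andP: te.
  by move=> t0; field; rewrite expf_neq0.
have [r [r0 fr]] : exists r, 0 < r /\ forall t, `|t| < r -> f (w + t) = 0.
  apply: real_analytic_identity fa _ => e' e'0.
  have [|t [/andP[t0]]] := acc (Num.min e e'); first by rewrite lt_min e0.
  rewrite lt_min => /andP[te te'] Dt; exists t; rewrite t0 te'; split=> //.
  by rewrite fD ?t0// Dt mul0r.
exists (Num.min e r); rewrite lt_min e0 r0; split=> // t /andP[t0].
rewrite lt_min => /andP[te tr]; have := fD t; rewrite t0 te fr// => /(_ isT)/esym/eqP.
by rewrite normr_gt0 in t0; rewrite mulf_eq0 expf_eq0 (negPf t0) andbF orbF => /eqP.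
Qed.

(** The points around which P h - Q vanishes form an open set, which is also
    closed by meromorphic_identity; it contains every point beyond 1. *)
Lemma meromorphic_continuation h P Q (b : R) :
  (forall w, b < w -> real_analytic P w) ->
  (forall w, b < w -> real_analytic Q w) ->
  (forall w, real_meromorphic h w) ->
  (forall s, 1 < s -> P s * h s = Q s) ->
  forall w, b < w -> vanishes_around (fun s => P s * h s - Q s) w.
Proof.
move=> Pa Qa hm PQ w bw.
set D := fun s => _; pose T := vanishes_around D.
have T1 x : 1 < x -> T x.
  move=> x1; exists (x - 1); rewrite subr_gt0; split => // t /andP[_].
  move=> tx; rewrite /D PQ ?subrr//.
  by have := ler_norm (- t); rewrite normrN; lra.
have [/T1//|w1] := ltP 1 w.
have Topen x : T x -> exists e, 0 < e /\ forall y, `|y - x| < e -> T y.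
  move=> [e [e0 De]]; exists e; split=> // y yx.
  have [->|ynx] := eqVneq y x; first by exists e.
  have d0 : 0 < `|y - x| by rewrite normr_gt0 subr_eq0.
  exists (Num.min `|y - x| (e - `|y - x|)); rewrite lt_min d0 subr_gt0; split=> // t.
  move=> /andP[t0]; rewrite lt_min => /andP[t1 t2].
  have -> : y + t = x + (y - x + t) by ring.
  apply: De; apply/andP; split; last by apply: (le_lt_trans (ler_normD _ _)); lra.
  rewrite normr_gt0; apply: contraTneq t1 => yxt.
  by rewrite (_ : t = - (y - x)) ?normrN ?ltxx//; move: yxt; lra.
(* A is bounded below by w; its infimum belongs to it and is w. *)
pose A := [set x | w <= x <= 2 /\ forall y, x <= y <= 2 -> T y].
have A2 : A 2.
  split; first by apply/andP; split; lra.
  by move=> y /andP[y2 _]; apply: T1; lra.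
have infA : has_inf A by split; [exists 2|exists w => x [/andP[]]].
pose sg := inf A.
have wsg : w <= sg by apply: lb_le_inf; [exists 2|move=> x [/andP[]]].
have sgA x : A x -> sg <= x by move=> Ax; apply: ge_inf => //; case: infA.
have Tsg : T sg.
  apply: meromorphic_identity => //; [by apply: Pa; lra|by apply: Qa; lra|].
  move=> e e0; have [x Ax xe] := inf_adherent e0 infA; rewrite -/sg in xe.
  have [|e' [e'0 De']] := Ax.2 x; first by rewrite lexx; case/andP: Ax.1.
  have sx := sgA _ Ax.
  (* x + u is a zero of D close to sg, and differs from sg even when x = sg. *)
  pose u := Num.min (e' / 2) ((sg + e - x) / 2).
  have u0 : 0 < u by rewrite lt_min !divr_gt0// subr_gt0.
  have [u1 u2] : u <= e' / 2 /\ u <= (sg + e - x) / 2 by rewrite !ge_min !lexx orbT.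
  exists (x + u - sg); split.
    by rewrite gtr0_norm; [apply/andP; split|]; lra.
  rewrite (_ : sg + _ = x + u); last by ring.
  by apply: De'; rewrite gtr0_norm// u0; lra.
suff -> : w = sg by [].
apply/eqP; rewrite eq_le wsg /= leNgt; apply/negP => wsg'.
have [e [e0 Te]] := Topen _ Tsg.
pose x := Num.max w (sg - e / 2).
have [xw xs] : w <= x /\ sg - e / 2 <= x by rewrite !le_max !lexx orbT.
have xsg : x < sg by rewrite gt_max wsg' /=; lra.
suff /sgA : A x by lra.
split; first by rewrite xw /=; have := sgA _ A2; lra.
move=> y /andP[xy y2]; have [ys|sy] := leP y sg.
  by apply: Te; rewrite ler0_norm ?subr_le0//; lra.
have [|z Az zy] := @inf_adherent _ A (y - sg) _ infA; first by rewrite subr_gt0.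
by apply: Az.2; rewrite y2 andbT; move: zy; rewrite -/sg; lra.
Qed.

(** If h = g / t^(k+1) near w, then P g - Q t^(k+1) is analytic and vanishes
    near w, so its value P(w) g(w) at w is zero. *)
Lemma pole_numerator_eq0 h P Q w g k :
  real_analytic P w -> real_analytic Q w -> real_analytic g w ->
  vanishes_around (fun s => P s * h s - Q s) w -> P w != 0 ->
  (exists e, 0 < e /\ forall t, 0 < `|t| < e -> h (w + t) = g (w + t) / t ^+ k.+1) ->
  g w = 0.
Proof.
move=> Pa Qa ga [e [e0 De]] Pw [e' [e'0 hg]].
pose f s := P s * g s - Q s * (s - w) ^+ k.+1.
have fa : real_analytic f w.
  apply: real_analyticB; apply: real_analyticM => //.
  by apply: real_analyticX; exact: real_analytic_center.
have [r [r0 fr]] : exists r, 0 < r /\ forall t, `|t| < r -> f (w + t) = 0.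
  apply: real_analytic_identity fa _ => d d0.
  pose t := Num.min (d / 2) (Num.min (e / 2) (e' / 2)).
  have t0 : 0 < t by rewrite !lt_min !divr_gt0.
  have [t1 t2 t3] : [/\ t <= d / 2, t <= e / 2 & t <= e' / 2].
    by rewrite /t !ge_min !lexx !orbT.
  have tn : `|t| = t by rewrite gtr0_norm.
  exists t; rewrite tn; split; first by apply/andP; split; lra.
  have := De t; rewrite tn => /(_ _)/eqP; rewrite subr_eq0 => DD.
  rewrite /f -(eqP (DD _)); last by apply/andP; split; lra.
  rewrite hg ?tn; last by apply/andP; split; lra.
  rewrite (_ : w + t - w = t); last by ring.
  by field; rewrite expf_neq0// gt_eqF.
have := fr 0; rewrite normr0 addr0 /f subrr expr0n mulr0 subr0 => /(_ r0)/eqP.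
by rewrite mulf_eq0 (negPf Pw) => /eqP.
Qed.

End RealAnalytic.

(** * Taylor coefficients of exponentials and summable weights *)

Section Exponentials.
Context {R : realType}.
Implicit Types (x y w X Y : R).

(** The k-th Taylor coefficient at s = w of s |-> exp (- s X). *)
Definition exp_taylor w X k : R := expR (- (w * X)) * exp_coeff (- X) k.

Lemma exp_taylor_series w X t :
  series (fun k => exp_taylor w X k * t ^+ k) @ \oo --> expR (- ((w + t) * X)).
Proof.
have -> : series (fun k => exp_taylor w X k * t ^+ k) =
    (fun n => expR (- (w * X)) * series (exp_coeff (- X * t)) n).
  apply/funext => n; rewrite /series /= mulr_sumr; apply: eq_bigr => k _.
  by rewrite /exp_taylor /exp_coeff /= exprMn; ring.
have -> : expR (- ((w + t) * X)) = expR (- (w * X)) * expR (- X * t).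
  by rewrite -expRD; congr expR; ring.
by apply: cvgMl_tmp; exact: is_cvg_series_exp_coeff.
Qed.

Lemma exp_coeff_le X k : 0 <= X -> X ^+ k / k`!%:R <= expR X.
Proof.
case: k => [|k] X0.
  by rewrite expr0 fact0 divr1; have := expR_ge1Dx X; lra.
by have := expR_ge1Dxn k X0; lra.
Qed.

(** (d X)^k / k! <= exp (d X): giving up d in the exponent makes the
    coefficients geometric with ratio 1/d, uniformly in X >= 0. *)
Lemma exp_taylor_le w X d k : 0 < d -> 0 <= X ->
  `|exp_taylor w X k| <= expR (- ((w - d) * X)) * d^-1 ^+ k.
Proof.
move=> d0 X0; rewrite /exp_taylor /exp_coeff /= normrM ger0_norm ?expR_ge0//.
have -> : expR (- ((w - d) * X)) = expR (- (w * X)) * expR (d * X).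
  by rewrite -expRD; congr expR; ring.
rewrite -mulrA ler_pM2l ?expR_gt0//.
rewrite normrM normrX normrN (ger0_norm X0) ger0_norm ?invr_ge0//.
rewrite exprVn ler_pdivlMr ?exprn_gt0//.
have := @exp_coeff_le (d * X) k; rewrite mulr_ge0 ?(ltW d0)// => /(_ isT).
by rewrite exprMn; lra.
Qed.

Lemma is_derive_exp_taylor w X k :
  is_derive X 1 (fun x => exp_taylor w x k)
    (- w * exp_taylor w X k - (if k is k'.+1 then exp_taylor w X k' else 0)).
Proof.
pose f1 x := expR (- (w * x)); pose f2 x := (- x) ^+ k.
have d1 : is_derive X 1 f1 (- w * expR (- (w * X))).
  rewrite /f1; apply: is_derive_eq; rewrite /GRing.scale /= ?mulr1; ring.
have d2 : is_derive X 1 f2 (- (k%:R * (- X) ^+ k.-1)).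
  have -> : f2 = (-%R : R -> R) ^+ k by apply/funext => x; rewrite /f2 exprfctE.
  by apply: is_derive_eq; rewrite /GRing.scale /=; ring.
have -> : (fun x => exp_taylor w x k) = (k`!%:R^-1 : R) *: (f1 * f2).
  apply/funext => x; rewrite /exp_taylor /exp_coeff !fctE /= /f1 /f2 /GRing.scale /=.
  by ring.
apply: (@is_derive_eq _ _ _ _ _ _ _ _ (is_deriveZ _ (is_deriveM d1 d2))).
rewrite /GRing.scale /= /f1 /f2 /exp_taylor /exp_coeff /=.
move=> {f1 f2 d1 d2}; case: k => [|k] /=.
  rewrite expr0 fact0 divr1 invr1. ring.
rewrite factS natrM exprS.
have k1 : k.+1%:R != 0 :> R by rewrite pnatr_eq0.
have kf : k`!%:R != 0 :> R by rewrite pnatr_eq0 -lt0n fact_gt0.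
by field; rewrite kf addrC natr1.
Qed.

(** Mean value theorem in X.  The factor |X - Y| is the gain that makes the
    differences of neighbouring terms summable. *)
Lemma exp_taylor_dist w X Y m d k : 0 < d -> d < w -> 0 <= X -> 0 <= Y ->
  m <= X -> m <= Y ->
  `|exp_taylor w X k - exp_taylor w Y k| <=
    `|X - Y| * ((w + d) * expR (- ((w - d) * m))) * d^-1 ^+ k.
Proof.
move=> d0 dw.
wlog XY : X Y / X <= Y.
  move=> H X0 Y0 mX mY; have [/H|/ltW /H] := leP X Y; first exact.
  by rewrite distrC (distrC Y); exact.
move=> X0 Y0 mX mY.
have [||c] := @MVT_segment _ (fun x => exp_taylor w x k)
   (fun x => - w * exp_taylor w x k - (if k is k'.+1 then exp_taylor w x k' else 0)) X Y XY.
- by move=> x _; exact: is_derive_exp_taylor.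
- apply: derivable_within_continuous => x _.
  by have [] := is_derive_exp_taylor w x k.
rewrite in_itv /= => /andP[Xc cY] E.
have c0 : 0 <= c by apply: le_trans Xc.
rewrite distrC E normrM (distrC X) mulrC -!mulrA.
apply: ler_wpM2l => //.
set Ec := expR _; have Em : expR (- ((w - d) * c)) <= Ec.
  by rewrite ler_expR lerN2 ler_wpM2l//; lra.
have dk : 0 <= d^-1 ^+ k by rewrite exprn_ge0// invr_ge0 ltW.
apply: (le_trans (ler_normB _ _)); rewrite mulrDl.
apply: lerD.
  rewrite normrM normrN (@ger0_norm _ w); last by lra.
  apply: ler_wpM2l; first by lra.
  by apply: (le_trans (exp_taylor_le w k d0 c0)); apply: ler_wpM2r.
case: k => [|k] in E dk *.
  by rewrite normr0 expr0 mulr1 mulr_ge0 ?expR_ge0// ltW.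
rewrite (_ : d * _ = Ec * d^-1 ^+ k); last by rewrite exprS; field; rewrite gt_eqF.
apply: (le_trans (exp_taylor_le w k d0 c0)); apply: ler_wpM2r => //.
by rewrite exprn_ge0// invr_ge0 ltW.
Qed.

Lemma ln_dist m x y : 0 < m -> m <= x -> m <= y ->
  `|ln x - ln y| <= `|x - y| / m.
Proof.
move=> m0; wlog xy : x y / x <= y.
  move=> H mx my; have [/H|/ltW /H] := leP x y; first exact.
  by rewrite distrC (distrC y); exact.
move=> mx my; have x0 : 0 < x by apply: lt_le_trans mx.
have y0 : 0 < y by apply: lt_le_trans my.
rewrite distrC (distrC x) !ger0_norm ?subr_ge0 ?ler_ln//.
rewrite -ln_div//.
have -> : y / x = 1 + (y - x) / x by field; rewrite gt_eqF.
have yx0 : 0 <= (y - x) / x by rewrite divr_ge0 ?subr_ge0// ltW.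
apply: (le_trans (le_ln1Dx _)); first by lra.
by apply: ler_wpM2l; rewrite ?subr_ge0// lef_pV2.
Qed.

Lemma powR_expR x s : 0 < x -> x `^ (- s) = expR (- (s * ln x)).
Proof. by move=> x0; rewrite /powR gt_eqF// mulNr. Qed.

Lemma le_powRN x y s : 0 < x -> x <= y -> 0 <= s -> y `^ (- s) <= x `^ (- s).
Proof.
move=> x0 xy s0; have y0 : 0 < y by apply: lt_le_trans xy.
rewrite !powR_expR// ler_expR lerN2 ler_wpM2l// ler_ln//.
Qed.

End Exponentials.

Section Weights.
Context {R : realType}.

Lemma has_sum_bool : has_sum (fun _ : bool => 1 : R) 2.
Proof.
apply/cvgrPdist_lt => e e0; exists [fset true; false]%fset => // A /= AT.
rewrite partial_sumE (_ : A = [fset true; false]%fset); last first.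
  apply/fsetP => b; rewrite !inE; have /fsubsetP/(_ b) := AT.
  by rewrite !inE; case: b => /= ->.
by rewrite big_fsetU1 ?inE//= big_seq_fset1 subrr normr0.
Qed.

(** Since v ln ((n+1)/n) >= v / (n+1), where v = u - 1. *)
Lemma powRN_telescope (u : R) n : 1 < u -> (0 < n)%N ->
  (u - 1) * n.+1%:R `^ (- u) <= n%:R `^ (- (u - 1)) - n.+1%:R `^ (- (u - 1)).
Proof.
move=> u1 n0; set v := u - 1.
have n0' : 0 < n%:R :> R by rewrite ltr0n.
have n1' : 0 < n.+1%:R :> R by rewrite ltr0n.
have v0 : 0 < v by rewrite /v subr_gt0.
have -> : - u = - v + (- 1) by rewrite /v; ring.
rewrite powRD; last by rewrite (gt_eqF n1') implybT.
rewrite (powR_inv1 (ltW n1')).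
have -> : n%:R `^ (- v) = n.+1%:R `^ (- v) * expR (v * (ln n.+1%:R - ln n%:R)) :> R.
  by rewrite !powR_expR// -expRD; congr expR; ring.
set E := n.+1%:R `^ (- v).
have E0 : 0 <= E by exact: powR_ge0.
rewrite -[X in _ <= _ - X]mulr1 -mulrBr mulrCA; apply: ler_wpM2l => //.
have l1 : n.+1%:R^-1 <= ln n.+1%:R - ln n%:R :> R.
  have := @le_ln1Dx R (- n.+1%:R^-1).
  have -> : 1 + - n.+1%:R^-1 = n%:R / n.+1%:R :> R.
    by rewrite -natr1; field; rewrite natr1 gt_eqF.
  rewrite ln_div ?posrE// => H.
  have : - 1 < - n.+1%:R^-1 :> R.
    by rewrite ltrN2 invf_lt1// ltr1n.
  by move=> /H; rewrite lerNr opprB.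
apply: (@le_trans _ _ (v * (ln n.+1%:R - ln n%:R))); first by rewrite ler_wpM2l// ltW.
by have := expR_ge1Dx (v * (ln n.+1%:R - ln n%:R) : R); lra.
Qed.

Lemma has_sum_zeta (u : R) : 1 < u ->
  exists B, has_sum (fun n : nat => n.+1%:R `^ (- u)) B.
Proof.
move=> u1; have v0 : 0 < u - 1 by rewrite subr_gt0.
pose S n : R := \sum_(i < n) i.+1%:R `^ (- u).
have SB n : (u - 1) * S n.+1 <= u - n.+1%:R `^ (- (u - 1)).
  elim: n => [|n IH].
    by rewrite /S big_ord_recl big_ord0 !powR1; lra.
  rewrite /S big_ord_recr /= -/(S _) mulrDr.
  have := @powRN_telescope u n.+1 u1 isT; lra.
apply: (@has_sum_bounded _ _ _ (u / (u - 1))); first by move=> i; exact: powR_ge0.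
move=> A; have [n An] : exists n, forall i, i \in A -> (i < n.+1)%N.
  exists (\max_(i <- A) i)%N => i iA; rewrite ltnS.
  exact: (@leq_bigmax_seq _ _ xpredT id).
rewrite ler_pdivlMr// mulrC.
apply: (@le_trans _ _ ((u - 1) * S n.+1)); last first.
  by apply: (le_trans (SB n)); rewrite gerBl powR_ge0.
rewrite ler_pM2l// /S -(big_mkord xpredT (fun i => i.+1%:R `^ (- u))).
rewrite [leRHS](bigID (mem A)) /= -[leLHS]addr0 lerD//; last first.
  by apply: sumr_ge0 => i _; exact: powR_ge0.
rewrite -[leRHS]big_filter le_eqVlt; apply/orP; left; apply/eqP; apply: perm_big.
apply: uniq_perm; rewrite ?fset_uniq ?filter_uniq ?iota_uniq// => i.
by rewrite mem_filter mem_index_iota /=; case: (boolP (i \in A)) => // /An ->.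
Qed.

Lemma has_sum_zeta_int (u : R) : 1 < u ->
  exists B, has_sum (fun m : int => (absz m).+1%:R `^ (- u)) B.
Proof.
move=> u1; have [B HB] := has_sum_zeta u1.
pose phi (p : bool * nat) : int := if p.1 then Posz p.2 else Negz p.2.
have phiI : injective phi by move=> [[] m] [[] n] //= [->].
have HBB := has_sum_prod (fun _ : bool => ler01 : 0 <= 1 :> R)
  (fun n : nat => powR_ge0 n.+1%:R (- u)) has_sum_bool HB.
have [|l Hl] := @has_sum_dominated R _
   ((fun m : int => (absz m).+1%:R `^ (- u)) \o phi) _ _ _ HBB.
  move=> [b n] /=; rewrite ger0_norm ?powR_ge0// mul1r.
  apply: le_powRN; rewrite ?ltr0n//; last by lra.
  by rewrite ler_nat; case: b => /=; lia.
exists l; have [||_] := has_sum_inj (f := fun m : int => (absz m).+1%:R `^ (- u)) l phiI.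
- by move=> j; exact: powR_ge0.
- by move=> [n|n] _; [exists (true, n)|exists (false, n)].
exact.
Qed.

(** A product of one-variable weights, so that its sum is a product of zeta
    values; it dominates the sums over levels and lattice vectors. *)
Definition weight (u : R) (i : nat * (int * int)) : R :=
  i.1.+1%:R `^ (- u) *
  ((absz i.2.1).+1%:R `^ (- u) * (absz i.2.2).+1%:R `^ (- u)).

Lemma has_sum_weight (u : R) : 1 < u -> exists B, has_sum (weight u) B.
Proof.
move=> u1; have [B HB] := has_sum_zeta u1; have [C HC] := has_sum_zeta_int u1.
exists (B * (C * C)); apply: (has_sum_prod _ _ HB (has_sum_prod _ _ HC HC)).
- by move=> i; exact: powR_ge0.
- by move=> j; rewrite mulr_ge0 ?powR_ge0.
- by move=> i; exact: powR_ge0.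
- by move=> i; exact: powR_ge0.
Qed.

End Weights.

(** * Analytic sums of exponentials, and the zeta factor *)

Section AnalyticSums.
Context {R : realType}.

(** Coefficients bounded by b i * e^(-k) with e <= w - a keep the domain of
    the estimates inside s > a, where the sum F is defined. *)
Lemma analytic_sum (I : choiceType) (d : I -> R -> R) (a : R) :
  (forall w, a < w -> exists (c : I -> nat -> R) (b : I -> R) B e,
     [/\ 0 < e, e <= w - a, has_sum b B,
         forall i k, `|c i k| <= b i * e^-1 ^+ k &
         forall i t, series (fun k => c i k * t ^+ k) @ \oo --> d i (w + t)]) ->
  exists F, forall s, a < s -> has_sum (d^~ s) (F s) /\ real_analytic F s.
Proof.
move=> H.
pose F s := xget 0 [set l | has_sum (d^~ s) l].
have FP s : a < s -> has_sum (d^~ s) (F s).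
  move=> as_; have [c [b [B [e [e0 _ bB cb cd]]]]] := H s as_.
  have [l Hl] : exists l, has_sum (d^~ s) l.
    apply: (has_sum_dominated _ (has_sumZ (a := 2) bB)) => i.
    have := @taylor_bound_series _ (d i) s (c i) (b i) e^-1 _ (cb i)
      (fun t _ => cd i t) 0 0%N.
    rewrite invr_gt0 normr0 mul0r big_ord0 subr0 expr0 mulr1 addr0.
    by apply.
  exact: (@xgetPex _ 0 [set l | has_sum (d^~ s) l] (ex_intro _ l Hl)).
exists F => s as_; split; first exact: FP.
have [c [b [B [e [e0 es bB cb cd]]]]] := H s as_.
apply: (real_analytic_family (c := c) (d := d) _ bB cb) => //.
  by rewrite invr_gt0.
move=> t; rewrite mulrA ler_pdivrMr// mul1r => te; apply: FP.
by have := ler_norm (- t); rewrite normrN; lra.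
Qed.

Lemma exp_taylorB_series w X Y t :
  series (fun k => (exp_taylor w X k - exp_taylor w Y k) * t ^+ k) @ \oo -->
    (expR (- ((w + t) * X)) - expR (- ((w + t) * Y)) : R).
Proof.
have -> : series (fun k => (exp_taylor w X k - exp_taylor w Y k) * t ^+ k) =
    series (fun k => exp_taylor w X k * t ^+ k) -
    series (fun k => exp_taylor w Y k * t ^+ k).
  apply/funext => n; rewrite fctE /series /= -sumrB.
  by apply: eq_bigr => k _; rewrite mulrBl.
by apply: cvgB; exact: exp_taylor_series.
Qed.

Lemma series_zero (t : R) : series (fun k => 0 * t ^+ k) @ \oo --> (0 : R).
Proof.
rewrite (_ : series _ = fun=> 0); first exact: cvg_cst.
by apply/funext => n; rewrite /series /= big1// => k _; rewrite mul0r.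
Qed.

Lemma real_analytic_powR (x w : R) : 0 < x -> real_analytic (fun s => x `^ (- s)) w.
Proof.
move=> x0; set X := ln x.
have e0 : 0 < `|X| + 1 by rewrite ltr_wpDl.
exists (exp_taylor w X), (2 * expR (- (w * X) + 1 * `|X|)), (2 * 1); split => //.
apply: taylor_bound_series => // [k|t _].
  rewrite expr1n mulr1 /exp_taylor /exp_coeff /= normrM ger0_norm ?expR_ge0//.
  rewrite expRD mul1r ler_pM2l ?expR_gt0//.
  rewrite normrM normrX normrN (@ger0_norm _ _^-1) ?invr_ge0//.
  exact: exp_coeff_le.
by rewrite powR_expR//; exact: exp_taylor_series.
Qed.

End AnalyticSums.

Section ZetaFactor.
Context {R : realType}.

(** The index (k, w) stands for the integer (k+1)^2 w. *)
Definition zeta_term (N : nat) (i : nat * nat) (s : R) : R :=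
  if (i.2 %| N)%N then (i.1.+1 ^ 2 * i.2)%:R `^ (- s) else 0.

Lemma zeta_factor_analytic (N : nat) : (0 < N)%N ->
  exists Z : R -> R, forall s, 2^-1 < s ->
    [/\ has_sum ((zeta_term N)^~ s) (Z s), 0 < Z s & real_analytic Z s].
Proof.
move=> N0.
have [Z HZ] : exists Z, forall s, 2^-1 < s ->
    has_sum ((zeta_term N)^~ s) (Z s) /\ real_analytic Z s.
  apply: analytic_sum => w w2.
  pose e := (w - 2^-1) / 2; have e0 : 0 < e by rewrite divr_gt0// subr_gt0.
  (* e is half the distance from w to 1/2, so that u = w + 1/2 > 1. *)
  pose u := 2 * (w - e).
  have u1 : 1 < u by rewrite /u /e; lra.
  have [B HB] := has_sum_zeta u1.
  pose K := N.+1%:R `^ u.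
  pose b (i : nat * nat) : R := i.1.+1%:R `^ (- u) * (K * i.2.+1%:R `^ (- u)).
  pose c (i : nat * nat) k :=
    if (i.2 %| N)%N then exp_taylor w (ln (i.1.+1 ^ 2 * i.2)%:R) k else 0.
  exists c, b, (B * (K * B)), e; split => //.
  - by rewrite /e; lra.
  - apply: (has_sum_prod _ _ HB (has_sumZ HB)).
      by move=> i; exact: powR_ge0.
    by move=> i; rewrite mulr_ge0 ?powR_ge0.
  - move=> [k w'] j; rewrite /c /b /=; case: ifPn => [wN|_]; last first.
      by rewrite normr0 mulr_ge0 ?exprn_ge0 ?invr_ge0 ?(ltW e0)// mulr_ge0 ?powR_ge0// mulr_ge0 ?powR_ge0.
    have w0 : (0 < w')%N by apply: dvdn_gt0 wN.
    have kw0 : (0 < k.+1 ^ 2 * w')%N by rewrite muln_gt0 expn_gt0.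
    apply: (le_trans (exp_taylor_le _ _ e0 _)).
      by rewrite ln_ge0// ler1n.
    apply: ler_wpM2r; first by rewrite exprn_ge0// invr_ge0 ltW.
    rewrite -powR_expR ?ltr0n//.
    apply: (@le_trans _ _ ((k.+1 ^ 2)%:R `^ (- (w - e)))).
      apply: le_powRN; rewrite ?ltr0n ?expn_gt0// ?ler_nat ?leq_pmulr//.
      by rewrite /u in u1; lra.
    rewrite natrX -powR_mulrn// -powRrM mulrN -/u.
    rewrite -[leLHS]mulr1; apply: ler_wpM2l; first exact: powR_ge0.
    have KE : K * N.+1%:R `^ (- u) = 1 by rewrite powRN mulfV// gt_eqF// powR_gt0.
    rewrite -[leLHS]KE; apply: ler_wpM2l; first exact: powR_ge0.
    by apply: le_powRN; [rewrite ltr0n|rewrite ler_nat ltnS dvdn_leq|lra].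
  - move=> [k w'] t; rewrite /c /zeta_term /=; case: ifPn => wN.
      have w0 : (0 < w')%N by apply: dvdn_gt0 wN.
      rewrite powR_expR; first exact: exp_taylor_series.
      by rewrite ltr0n muln_gt0 expn_gt0.
    exact: series_zero.
exists Z => s s2; have [H1 H2] := HZ s s2; split=> //.
apply: (@lt_le_trans _ _ 1) => //.
have := @has_sum_partial_le _ _ _ _ [fset (0, 1)%N]%fset _ H1.
rewrite big_seq_fset1 /zeta_term /= dvd1n powR1; apply => i.
by case: ifP => // _; exact: powR_ge0.
Qed.

End ZetaFactor.

(** * Continuation of lattice sums by doubling *)

Section Doubling.
Context {R : realType}.
Implicit Types (u v : int * int).

Definition supn v : nat := maxn (absz v.1) (absz v.2).
Definition twice v : int * int := (2 * v.1, 2 * v.2).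
(** Rounded towards minus infinity, so that each vector is twice (halve v)
    plus a unique vector with entries 0 and 1. *)
Definition halve v : int * int := ((v.1 %/ 2)%Z, (v.2 %/ 2)%Z).

Lemma supn_gt0 v : v != (0, 0) -> (0 < supn v)%N.
Proof. by case: v => m n; rewrite xpair_eqE /supn /=; lia. Qed.

Lemma halve_neq0 v : halve v != (0, 0) -> v != (0, 0).
Proof. by apply: contraNneq => ->. Qed.

Lemma supn_twice_halve v : halve v != (0, 0) ->
  (supn v <= 2 * supn (twice (halve v)))%N.
Proof.
case: v => m n; rewrite /halve /twice /supn xpair_eqE /=.
have := divz_eq m 2; have := divz_eq n 2.
have := modz_ge0 m (isT : (2 : int) != 0); have := modz_ge0 n (isT : (2 : int) != 0).
have := ltz_pmod m (isT : (0 : int) < 2); have := ltz_pmod n (isT : (0 : int) < 2).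
lia.
Qed.

Lemma supn_halve0 v : v != (0, 0) -> halve v = (0, 0) -> supn v = 1%N.
Proof.
case: v => m n; rewrite /halve /supn xpair_eqE /= => mn [].
have := divz_eq m 2; have := divz_eq n 2.
have := modz_ge0 m (isT : (2 : int) != 0); have := modz_ge0 n (isT : (2 : int) != 0).
have := ltz_pmod m (isT : (0 : int) < 2); have := ltz_pmod n (isT : (0 : int) < 2).
lia.
Qed.

(** The properties of the forms |f m z + n|^2 / f on which the continuation of
    their zeta function rests. *)
Record comparable_form (N : nat) (q : nat -> int * int -> R) (K : R) : Prop :=
  ComparableForm {
    form_ge : forall f v, (f %| N)%N -> (supn v)%:R ^+ 2 <= q f v;
    form_twice : forall f v, (f %| N)%N -> q f (twice v) = 4 * q f v;
    form_halve : forall f v, (f %| N)%N ->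
      `|q f v - q f (twice (halve v))| <= K * (supn v)%:R }.

Definition admissible (N : nat) (i : nat * (int * int)) : bool :=
  (i.1 %| N)%N && (i.2 != (0, 0)).

Definition lattice_term N (q : nat -> int * int -> R) (i : nat * (int * int)) (s : R) : R :=
  if admissible N i then q i.1 i.2 `^ (- s) else 0.

Definition even_term N (q : nat -> int * int -> R) (i : nat * (int * int)) (s : R) : R :=
  if admissible N (i.1, halve i.2) then q i.1 (twice (halve i.2)) `^ (- s) else 0.

(** max(|m|, |n|)^2 >= (|m|+1) (|n|+1) / 4 for a nonzero vector, and the
    level is at most N. *)
Lemma weight_bound N (u : R) i : (0 < N)%N -> 1 < u -> admissible N i ->
  ((supn i.2)%:R ^+ 2) `^ (- u) <= (4 * N.+1)%:R `^ u * weight u i.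
Proof.
case: i => f [m n] N0 u1 /andP[/= fN v0].
have s0 := supn_gt0 v0; have f0 : (f <= N)%N by apply: dvdn_leq.
have N4 : 0 < (4 * N.+1)%:R :> R by rewrite ltr0n.
have -> : ((supn (m, n))%:R ^+ 2) `^ (- u) =
    (4 * N.+1)%:R `^ u * ((4 * N.+1)%:R * (supn (m, n))%:R ^+ 2) `^ (- u) :> R.
  have s2 : 0 <= (supn (m, n))%:R ^+ 2 :> R by rewrite exprn_ge0.
  rewrite (powRM _ (ltW N4) s2).
  rewrite mulrA (_ : _ `^ u * _ `^ (- u) = 1) ?mul1r//.
  by rewrite powRN mulfV// gt_eqF// powR_gt0.
apply: ler_wpM2l; first exact: powR_ge0.
rewrite /weight /= -!powRM ?mulr_ge0//.
apply: le_powRN; last by lra.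
  by rewrite !mulr_gt0// ltr0n.
rewrite -natrX -!natrM ler_nat.
have mS : ((absz m).+1 <= 2 * supn (m, n))%N by rewrite /supn /= in s0 *; lia.
have nS : ((absz n).+1 <= 2 * supn (m, n))%N by rewrite /supn /= in s0 *; lia.
apply: (@leq_trans (N.+1 * (2 * supn (m, n) * (2 * supn (m, n))))).
  by rewrite !leq_mul.
by rewrite leq_eqVlt; apply/orP; left; apply/eqP; ring.
Qed.

Variables (N : nat) (q : nat -> int * int -> R) (K : R).
Hypotheses (N0 : (0 < N)%N) (qK : comparable_form N q K).

Lemma form_ge1 i : admissible N i -> 1 <= q i.1 i.2.
Proof.
move=> /andP[iN /supn_gt0 i0]; apply: le_trans (form_ge qK _ iN).
by rewrite -natrX ler1n expn_gt0 i0.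
Qed.

Lemma form_bound_ge0 : 0 <= K.
Proof.
have := form_halve qK (1, 0) (dvd1n N).
by rewrite mulr1; apply: le_trans.
Qed.

Lemma admissible_halve i : admissible N (i.1, halve i.2) -> admissible N i.
Proof. by move=> /andP[iN /halve_neq0 i0]; rewrite /admissible iN. Qed.

Lemma admissible_twice i : admissible N i -> admissible N (i.1, twice i.2).
Proof.
case: i => f [m n] /andP[/= fN]; rewrite /admissible fN /twice !xpair_eqE /=.
lia.
Qed.

Lemma lattice_term_ge0 i s : 0 <= lattice_term N q i s.
Proof. by rewrite /lattice_term; case: ifP => // _; exact: powR_ge0. Qed.

Lemma has_sum_lattice s : 1 < s -> exists S, has_sum ((lattice_term N q)^~ s) S.
Proof.
move=> s1; have [B HB] := has_sum_weight s1.
apply: (has_sum_dominated _ (has_sumZ (a := (4 * N.+1)%:R `^ s) HB)) => i.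
rewrite ger0_norm ?lattice_term_ge0// /lattice_term; case: ifPn => [ai|_].
  apply: le_trans (weight_bound N0 s1 ai).
  case/andP: (ai) => iN /supn_gt0 i0.
  apply: le_powRN; [|exact: (form_ge qK)|lra].
  by rewrite exprn_gt0// ltr0n.
by rewrite !mulr_ge0 ?powR_ge0.
Qed.

(** Each nonzero even vector is twice (halve v) for exactly four v, and
    doubling a vector multiplies q by 4. *)
Lemma has_sum_even s S : has_sum ((lattice_term N q)^~ s) S ->
  has_sum ((even_term N q)^~ s) (4 * 4 `^ (- s) * S).
Proof.
move=> HS.
pose phi (p : (nat * (int * int)) * (bool * bool)) : nat * (int * int) :=
  (p.1.1, (2 * p.1.2.1 + p.2.1%:Z, 2 * p.1.2.2 + p.2.2%:Z)).
have halfphi p : halve (phi p).2 = p.1.2.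
  case: p => [[f [m n]] [a b]]; rewrite /phi /halve /=; congr (_, _).
    by rewrite mulrC divzMDl// divz_small ?addr0//; case: a.
  by rewrite mulrC divzMDl// divz_small ?addr0//; case: b.
have phiI : injective phi.
  move=> [[f [m n]] [a b]] [[f' [m' n']] [a' b']] E.
  have := halfphi (f, (m, n), (a, b)); rewrite E halfphi /= => -[mm nn].
  move: E; rewrite /phi /= mm nn => -[-> /addrI + /addrI].
  by case: a; case: a' => // _; case: b; case: b'.
have mod2 (m : int) : ((m %% 2)%Z == 1)%:Z = (m %% 2)%Z.
  have := modz_ge0 m (isT : (2 : int) != 0).
  have := ltz_pmod m (isT : (0 : int) < 2).
  by case: eqP => [->//|] /=; lia.
have phiS i : exists p, phi p = i.
  case: i => f [m n].
  exists ((f, ((m %/ 2)%Z, (n %/ 2)%Z)), ((m %% 2)%Z == 1, (n %% 2)%Z == 1)).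
  rewrite /phi /=; congr (_, (_, _)).
    by rewrite mod2 mulrC -divz_eq.
  by rewrite mod2 mulrC -divz_eq.
have even0 i : 0 <= even_term N q i s.
  by rewrite /even_term; case: ifP => // _; exact: powR_ge0.
apply/(has_sum_inj _ phiI) => //.
have H22 : has_sum (fun _ : bool * bool => 1 * 1) (2 * 2 : R).
  exact: (has_sum_prod (fun _ => ler01) (fun _ => ler01) has_sum_bool has_sum_bool).
have H := has_sum_prod _ _ (has_sumZ (a := 4 `^ (- s)) HS) H22.
have -> : 4 * 4 `^ (- s) * S = 4 `^ (- s) * S * (2 * 2) by ring.
apply: eq_has_sum (H _ _) => [p||].
- case: p => [[f v] ab]; rewrite !mulr1 /even_term /lattice_term /comp halfphi /=.
  case: ifPn => [ap|]; last by rewrite mulr0.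
  rewrite (form_twice qK)//; last by case/andP: ap.
  by rewrite powRM// (le_trans _ (form_ge1 ap)).
- by move=> i; rewrite mulr_ge0 ?powR_ge0 ?lattice_term_ge0.
- by move=> j; rewrite mulr1.
Qed.

(** H is the sum of lattice_term - even_term.  A vector and its rounding
    differ by a bounded amount, so the logarithms of q at the two differ by
    O(1/|v|), and the Taylor coefficients of the difference at w are
    O(|v|^(-2w-1+2e) e^(-k)). *)
Lemma doubling_sum : exists H : R -> R,
  (forall s, 2^-1 < s -> real_analytic H s) /\
  (forall s S, 1 < s -> has_sum ((lattice_term N q)^~ s) S ->
     H s = (1 - 4 * 4 `^ (- s)) * S).
Proof.
have [H HH] : exists H, forall s, 2^-1 < s ->
    has_sum ((fun i s => lattice_term N q i s - even_term N q i s)^~ s) (H s)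
    /\ real_analytic H s.
  apply: analytic_sum => w w2.
  pose e := (w - 2^-1) / 2; have e0 : 0 < e by rewrite divr_gt0// subr_gt0.
  have ew : e < w by rewrite /e; lra.
  (* (|v|^2)^(-u) = |v|^(-2(w-e)-1), and u > 1 by the choice of e. *)
  pose u := w - e + 2^-1.
  have u1 : 1 < u by rewrite /u /e; lra.
  have [B HB] := has_sum_weight u1.
  have K0 := form_bound_ge0.
  have p4 : 0 <= 4 `^ (w - e) by exact: powR_ge0.
  pose K' := 1 + 4 * K * (w + e) * 4 `^ (w - e).
  have K'1 : 1 <= K' by rewrite lerDl !mulr_ge0//; lra.
  pose b i := K' * (4 * N.+1)%:R `^ u * weight u i.
  pose c (i : nat * (int * int)) k :=
    (if admissible N i then exp_taylor w (ln (q i.1 i.2)) k else 0) -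
    (if admissible N (i.1, halve i.2) then exp_taylor w (ln (q i.1 (twice (halve i.2)))) k else 0).
  exists c, b, (K' * (4 * N.+1)%:R `^ u * B), e; split => //.
  - by rewrite /e; lra.
  - exact: has_sumZ.
  - move=> [f v] k; rewrite /c.
    have dk : 0 <= e^-1 ^+ k by rewrite exprn_ge0// invr_ge0 ltW.
    case: ifPn => [ai|nai]; last first.
      rewrite ifN; last by apply: contraNN nai; exact: admissible_halve.
      rewrite subr0 normr0 mulr_ge0// /b !mulr_ge0 ?powR_ge0//.
      by apply: le_trans K'1.
    case/andP: (ai) => /= fN v0; have sv := supn_gt0 v0.
    have sv' : 0 < (supn v)%:R ^+ 2 :> R by rewrite exprn_gt0// ltr0n.
    have q1 := form_ge1 ai.
    have l0 : 0 <= ln (q f v) by rewrite ln_ge0.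
    suff Hc : `|exp_taylor w (ln (q f v)) k - (if admissible N (f, halve v)
        then exp_taylor w (ln (q f (twice (halve v)))) k else 0)| <=
        K' * ((supn v)%:R ^+ 2) `^ (- u) * e^-1 ^+ k.
      apply: (le_trans Hc); apply: ler_wpM2r => //; rewrite /b -mulrA.
      by apply: ler_wpM2l; [exact: le_trans K'1|exact: (@weight_bound _ _ (f, v))].
    case: ifPn => [ah|nah]; last first.
      have hv0 : halve v = (0, 0).
        by apply/eqP; move: nah; rewrite /admissible /= fN /= negbK.
      rewrite (supn_halve0 v0 hv0) expr1n powR1 mulr1 subr0.
      apply: (le_trans (exp_taylor_le w k e0 l0)); apply: ler_wpM2r => //.
      apply: le_trans K'1; rewrite -expR0 ler_expR oppr_le0 mulr_ge0//; lra.
    have hv := proj2 (andP ah).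
    have q'1 := form_ge1 (admissible_twice ah).
    have l0' : 0 <= ln (q f (twice (halve v))) by rewrite ln_ge0.
    pose sr : R := (supn v)%:R; have sr0 : 0 < sr by rewrite ltr0n.
    (* m bounds q from below at both vectors, as rounding at most halves |v|. *)
    pose m : R := sr ^+ 2 / 4; have m0 : 0 < m by rewrite divr_gt0.
    have mq : m <= q f v.
      by apply: le_trans (form_ge qK v fN); rewrite /m /sr; lra.
    have mq' : m <= q f (twice (halve v)).
      apply: le_trans (form_ge qK _ fN).
      rewrite /m ler_pdivrMr// (_ : 4 = 2 ^+ 2 :> R) -?exprMn; last by rewrite expr2 -natrM.
      apply: lerXn2r; [by rewrite nnegrE ltW|by rewrite nnegrE mulr_ge0|].
      by rewrite -natrM ler_nat mulnC supn_twice_halve.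
    have q0 : 0 < q f v by apply: lt_le_trans q1.
    have q'0 : 0 < q f (twice (halve v)) by apply: lt_le_trans q'1.
    have lm : ln m <= ln (q f v) by rewrite ler_ln.
    have lm' : ln m <= ln (q f (twice (halve v))) by rewrite ler_ln.
    apply: (le_trans (exp_taylor_dist k e0 ew l0 l0' lm lm')).
    apply: ler_wpM2r => //.
    rewrite -powR_expR//.
    have dl : `|ln (q f v) - ln (q f (twice (halve v)))| <= 4 * K / sr.
      apply: (le_trans (ln_dist m0 mq mq')).
      rewrite ler_pdivrMr//; apply: (le_trans (form_halve qK v fN)).
      rewrite /m -/sr le_eqVlt; apply/orP; left; apply/eqP; field.
      by rewrite gt_eqF.
    have sE : (sr ^+ 2) `^ (- u) = (sr ^+ 2) `^ (- (w - e)) / sr.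
      have -> : - u = - (w - e) + - 2^-1 by rewrite /u; ring.
      rewrite powRD; last by rewrite (gt_eqF sv') implybT.
      congr (_ * _); rewrite -(powR_mulrn 2 (ltW sr0)) -powRrM.
      rewrite (_ : 2%:R * - 2^-1 = - 1); first exact: powR_inv1 (ltW sr0).
      by field.
    have mE : m `^ (- (w - e)) = (sr ^+ 2) `^ (- (w - e)) * 4 `^ (w - e).
      by rewrite /m powRM ?invr_ge0// ?(ltW sv')// -[4^-1](powR_inv1 _)// -powRrM mulN1r opprK.
    rewrite -/sr sE mE.
    set A := (sr ^+ 2) `^ _; have A0 : 0 <= A by exact: powR_ge0.
    apply: (@le_trans _ _ (4 * K / sr * ((w + e) * (A * 4 `^ (w - e))))).
      by apply: ler_wpM2r => //; rewrite !mulr_ge0//; lra.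
    rewrite (_ : _ * _ = (K' - 1) * (A / sr)); last first.
      by rewrite /K'; field; rewrite gt_eqF.
    by apply: ler_wpM2r; [rewrite divr_ge0// ltW|lra].
  - move=> [f v] t; rewrite /c /lattice_term /even_term /=.
    have [ai|nai] := boolP (admissible N (f, v)); last first.
      have /negPf -> : ~~ admissible N (f, halve v).
        by apply: contraNN nai; exact: (@admissible_halve (f, v)).
      by under eq_fun do rewrite subr0; rewrite subr0; exact: series_zero.
    rewrite powR_expR; last by apply: lt_le_trans (form_ge1 ai).
    have [ah|nah] := boolP (admissible N (f, halve v)).
      rewrite powR_expR; last by apply: lt_le_trans (form_ge1 (admissible_twice ah)).
      exact: exp_taylorB_series.
    by under eq_fun do rewrite subr0; rewrite subr0; exact: exp_taylor_series.
exists H; split=> [s /HH[]//|s S s1 HS].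
have [|Hs _] := HH s; first by lra.
have := has_sumB HS (has_sum_even HS) => /(has_sum_unique Hs) ->; ring.
Qed.

(** Otherwise the partial sums at s = 1 would be bounded too, by continuity;
    but the vectors (m, k) with 0 <= k < m alone contribute at least
    1 / (K2 m) for each m. *)
Lemma lattice_unbounded K2 B r : (forall v, q 1 v <= K2 * (supn v)%:R ^+ 2) -> 0 < r ->
  (forall s S, 1 < s < 1 + r -> has_sum ((lattice_term N q)^~ s) S -> S <= B) -> False.
Proof.
move=> qK2 r0 SB.
have partial1 (A : {fset nat * (int * int)}) : \sum_(i <- A) lattice_term N q i 1 <= B.
  pose L := \sum_(i <- A) lattice_term N q i 1 * `|ln (q i.1 i.2)|.
  have L0 : 0 <= L.
    by apply: sumr_ge0 => i _; rewrite mulr_ge0// lattice_term_ge0.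
  apply/ler_addgt0Pr => e e0.
  (* Going from s = 1 to 1 + t lowers the partial sum by at most t L <= e. *)
  pose t := Num.min (r / 2) (e / (L + 1)).
  have L1 : 0 < L + 1 by rewrite ltr_wpDl.
  have t0 : 0 < t by rewrite lt_min !divr_gt0.
  have tr : t < r by rewrite gt_min; apply/orP; left; lra.
  have tL : t * L <= e.
    apply: (@le_trans _ _ (t * (L + 1))); first by rewrite ler_wpM2l ?ltW//; lra.
    by rewrite -ler_pdivlMr// ge_min lexx orbT.
  have s1 : 1 < 1 + t by rewrite ltrDl.
  have [S HS] := has_sum_lattice s1.
  have SB' : S <= B by apply: SB HS; rewrite s1 ltrD2l.
  have AS : \sum_(i <- A) lattice_term N q i (1 + t) <= S.
    by apply: has_sum_partial_le HS => i; exact: lattice_term_ge0.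
  suff H : \sum_(i <- A) lattice_term N q i 1 - t * L <= \sum_(i <- A) lattice_term N q i (1 + t) by lra.
  rewrite /L mulr_sumr -sumrB; apply: ler_sum => i _.
  rewrite /lattice_term; case: ifPn => [ai|_]; last by rewrite mul0r mulr0 subr0.
  have q0 : 0 < q i.1 i.2 by apply: lt_le_trans (form_ge1 ai).
  have -> : - (1 + t) = - 1 + - t by ring.
  rewrite powRD; last by rewrite (gt_eqF q0) implybT.
  rewrite mulrCA -[X in X - _]mulr1 -mulrBr; apply: ler_wpM2l; first exact: powR_ge0.
  rewrite powR_expR//; have := expR_ge1Dx (- (t * ln (q i.1 i.2))).
  have : t * ln (q i.1 i.2) <= t * `|ln (q i.1 i.2)| by rewrite ler_wpM2l ?ler_norm// ltW.
  lra.
have K20 : 0 < K2.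
  have a1 : admissible N (1%N, (1, 0)) by rewrite /admissible dvd1n.
  have := le_trans (form_ge1 a1) (qK2 (1, 0)).
  by rewrite expr1n mulr1; exact: lt_le_trans.
have harm n : \sum_(0 <= m < n) (m.+1%:R : R)^-1 <= K2 * B.
  pose rows := [seq (1%N, (m.+1%:Z, k%:Z)) | m <- iota 0 n, k <- iota 0 m.+1].
  have urows : uniq rows.
    apply: allpairs_uniq_dep; rewrite ?iota_uniq//; first by move=> m _; exact: iota_uniq.
    by move=> [m k] [m' k'] _ _ /= [-> ->].
  have E := partial1 [fset i in rows]%fset.
  have {}E : \sum_(i <- rows) lattice_term N q i 1 <= B.
    apply: le_trans E; rewrite le_eqVlt; apply/orP; left; apply/eqP/perm_big.
    by apply: uniq_perm => [//||i]; [exact: fset_uniq|rewrite inE].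
  rewrite big_allpairs_dep in E.
  rewrite -ler_pdivrMl//; apply: le_trans E.
  rewrite mulr_sumr /index_iota subn0; apply: ler_sum => m _.
  have -> : K2^-1 * m.+1%:R^-1 = \sum_(k <- iota 0 m.+1) (K2^-1 * m.+1%:R^-1 ^+ 2) :> R.
    rewrite big_const_seq count_predT size_iota iter_addr_0 -mulr_natr.
    by field; rewrite nat1r pnatr_eq0 (gt_eqF K20).
  rewrite big_seq [leRHS]big_seq; apply: ler_sum => k; rewrite mem_iota /= => km.
  rewrite /lattice_term /admissible dvd1n xpair_eqE /=.
  have ai : admissible N (1%N, (m.+1%:Z, k%:Z)) by rewrite /admissible dvd1n xpair_eqE.
  have q0 : 0 < q 1 (m.+1%:Z, k%:Z) by apply: lt_le_trans (form_ge1 ai).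
  rewrite powR_inv1 ?(ltW q0)// exprVn -invfM.
  have KM : 0 < K2 * m.+1%:R ^+ 2 by rewrite mulr_gt0// exprn_gt0.
  rewrite lef_pV2 ?posrE//.
  apply: (le_trans (qK2 _)); rewrite (_ : supn _ = m.+1)// /supn /=.
  by apply/maxn_idPl; lia.
apply: (@dvg_harmonic R _); apply: nondecreasing_is_cvgn.
  by apply/nondecreasing_seqP => n; rewrite seriesSr lerDl harmonic_ge0.
by exists (K2 * B) => _ [n _ <-]; exact: harm.
Qed.

End Doubling.

(** * Encoding lattice vectors by primitive rows *)

Section Arithmetic.
Implicit Types (N f e w C D : nat).

Lemma squarefree_dvd N f : squarefree N -> (f %| N)%N -> squarefree f.
Proof. by move=> sN fN d df; apply: sN; apply: dvdn_trans fN. Qed.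

Lemma squarefree_coprime N f : squarefree N -> (f %| N)%N -> coprime f (N %/ f).
Proof.
move=> sN fN; apply/eqP/sN; rewrite -[X in (_ %| X)%N](divnK fN) expnS expn1.
by rewrite dvdn_mul ?dvdn_gcdl// dvdn_gcdr.
Qed.

(** A common divisor of N / gcd(m, N) and m divides both factors of N, which
    are coprime. *)
Lemma squarefree_coprime_quot N m : (0 < N)%N -> squarefree N ->
  coprime (N %/ gcdn m N) m.
Proof.
move=> N0 sN.
have gN : (gcdn m N %| N)%N by exact: dvdn_gcdr.
have cp := squarefree_coprime sN gN.
rewrite /coprime -dvdn1; set t := gcdn _ m.
have tq : (t %| N %/ gcdn m N)%N by exact: dvdn_gcdl.
have tg : (t %| gcdn m N)%N.
  by rewrite dvdn_gcd dvdn_gcdr (dvdn_trans tq)// dvdn_div.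
by rewrite -(eqP cp) dvdn_gcd tg.
Qed.

(** The condition on c, d (here in absolute value) for sqrt(N/f) (f c, d) to
    be the bottom row of an element of the group. *)
Definition primitive_row N f C D : bool :=
  (f %| N)%N && coprime (N %/ f * D) (f * C).

(** The factors f and N/f of a square-free N are coprime, so a divisor of N
    is the product of its parts in each. *)
Lemma gcdn_split N f w : (0 < N)%N -> squarefree N -> (f %| N)%N -> (w %| N)%N ->
  (gcdn w f * gcdn w (N %/ f))%N = w.
Proof.
move=> N0 sN fN wN; have cp := squarefree_coprime sN fN.
have w0 : (0 < w)%N by apply: dvdn_gt0 wN.
have a0 : (0 < gcdn w f)%N by rewrite gcdn_gt0 w0.
apply/eqP; rewrite eqn_dvd; apply/andP; split.
  rewrite Gauss_dvd ?dvdn_gcdl//.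
  by apply: coprime_dvdl (dvdn_gcdr _ _) _; apply: coprime_dvdr (dvdn_gcdr _ _) _.
set a := gcdn w f.
have aw : (a %| w)%N by exact: dvdn_gcdl.
have af : (a %| f)%N by exact: dvdn_gcdr.
rewrite -[X in (X %| _)%N](divnK aw) mulnC dvdn_pmul2l// dvdn_gcd dvdn_div//=.
have cwf : coprime (w %/ a) (f %/ a).
  rewrite /coprime -(eqn_pmul2r a0) mul1n muln_gcdl !divnK//.
rewrite -(Gauss_dvdr _ cwf) -(dvdn_pmul2r a0) divnK//.
by rewrite mulnAC divnK// mulnC divnK.
Qed.

Section Encode.
Variables (N f w k C D : nat).
Hypotheses (N0 : (0 < N)%N) (sN : squarefree N) (k0 : (0 < k)%N).
Hypotheses (pr : primitive_row N f C D) (wN : (w %| N)%N).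
Let e := (N %/ f)%N.
Let a := gcdn w f.
Let b := gcdn w e.
Let f' := (f %/ a * b)%N.

(** The letters a and b stand for the parts of w in f and in e; encoding
    moves the primes of a out of the level and those of b into it. *)
Lemma encode_facts : [/\ (0 < f)%N, (0 < e)%N, (0 < a)%N & (0 < b)%N] /\
  [/\ (a %| f)%N, (b %| e)%N, (f * e = N)%N & (a * b = w)%N].
Proof.
have fN := proj1 (andP pr).
have w0 : (0 < w)%N by apply: dvdn_gt0 wN.
have f0 : (0 < f)%N by apply: dvdn_gt0 fN.
have e0 : (0 < e)%N by rewrite divn_gt0// dvdn_leq.
split; split => //; rewrite ?gcdn_gt0 ?w0 ?dvdn_gcdr//.
- by rewrite mulnC divnK.
- exact: gcdn_split.
Qed.

Lemma encode_coprime : coprime (a * C) (b * D).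
Proof.
have [[f0 e0 a0 b0] [af be fe ab]] := encode_facts.
have cp := proj2 (andP pr); rewrite coprime_sym in cp.
apply: coprime_dvdl (coprime_dvdr _ cp); first by rewrite dvdn_mul.
by rewrite dvdn_mul.
Qed.

Lemma encode_dvd : (f' %| N)%N.
Proof.
have [[f0 e0 a0 b0] [af be fe ab]] := encode_facts.
by rewrite /f' -fe dvdn_mul// dvdn_div.
Qed.

Lemma encode_cofactor : (N %/ f' = e %/ b * a)%N.
Proof.
have [[f0 e0 a0 b0] [af be fe ab]] := encode_facts.
have f'0 : (0 < f')%N by rewrite muln_gt0 divn_gt0// dvdn_leq.
apply/eqP; rewrite -(eqn_pmul2r f'0) divnK ?encode_dvd// -fe /f'.
by rewrite -{1}(divnK af) -{1}(divnK be); apply/eqP; ring.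
Qed.

(** This lemma and the next three recover k, a, b and the old level from the
    encoded data: k is the content of the vector, and a, b are the common
    factors of its primitive part with the complementary level and the new
    level. *)
Lemma decode_gcd : gcdn (k * (a * C)) (k * (b * D)) = k.
Proof. by rewrite -muln_gcdr (eqP encode_coprime) muln1. Qed.

Lemma decode_l : gcdn (a * C) (N %/ f') = a.
Proof.
have [[f0 e0 a0 b0] [af be fe ab]] := encode_facts.
rewrite encode_cofactor [(_ * a)%N]mulnC -muln_gcdr.
have /eqP -> : coprime C (e %/ b); last by rewrite muln1.
have cp := proj2 (andP pr); rewrite coprime_sym in cp.
apply: coprime_dvdl (coprime_dvdr _ cp); first exact: dvdn_mull.
by apply: dvdn_mulr; exact: dvdn_div.
Qed.

Lemma decode_r : gcdn (b * D) f' = b.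
Proof.
have [[f0 e0 a0 b0] [af be fe ab]] := encode_facts.
rewrite /f' [(_ * b)%N]mulnC -muln_gcdr.
have /eqP -> : coprime D (f %/ a); last by rewrite muln1.
have cp := proj2 (andP pr).
apply: coprime_dvdl (coprime_dvdr _ cp); first exact: dvdn_mull.
by apply: dvdn_mulr; exact: dvdn_div.
Qed.

Lemma decode_level : (f' %/ b * a = f)%N.
Proof.
have [[f0 e0 a0 b0] [af be fe ab]] := encode_facts.
by rewrite /f' mulnK// divnK.
Qed.

End Encode.

Lemma encode_inj N f1 w1 k1 C1 D1 f2 w2 k2 C2 D2 :
  (0 < N)%N -> squarefree N -> (0 < k1)%N -> (0 < k2)%N ->
  primitive_row N f1 C1 D1 -> primitive_row N f2 C2 D2 ->
  (w1 %| N)%N -> (w2 %| N)%N ->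
  (f1 %/ gcdn w1 f1 * gcdn w1 (N %/ f1) = f2 %/ gcdn w2 f2 * gcdn w2 (N %/ f2))%N ->
  (k1 * (gcdn w1 f1 * C1) = k2 * (gcdn w2 f2 * C2))%N ->
  (k1 * (gcdn w1 (N %/ f1) * D1) = k2 * (gcdn w2 (N %/ f2) * D2))%N ->
  [/\ k1 = k2, w1 = w2, f1 = f2 & C1 = C2 /\ D1 = D2].
Proof.
move=> N0 sN k10 k20 p1 p2 wN1 wN2 Ef EC ED.
have Ek : k1 = k2.
  by rewrite -(decode_gcd k1 N0 sN p1 wN1) EC ED (decode_gcd k2 N0 sN p2 wN2).
have /eqP := EC; rewrite Ek eqn_pmul2l// => /eqP EC'.
have /eqP := ED; rewrite Ek eqn_pmul2l// => /eqP ED'.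
have Ea := decode_l N0 sN p1 wN1; rewrite EC' Ef (decode_l N0 sN p2 wN2) in Ea.
have Eb := decode_r N0 sN p1 wN1; rewrite ED' Ef (decode_r N0 sN p2 wN2) in Eb.
have E1 := decode_level N0 sN p1 wN1; rewrite Ef -Ea -Eb (decode_level N0 sN p2 wN2) in E1.
have [[_ _ a10 b10] [_ _ _ W1]] := encode_facts N0 sN p1 wN1.
have [[_ _ a20 b20] [_ _ _ W2]] := encode_facts N0 sN p2 wN2.
split=> //; first by rewrite -W1 -W2 Ea Eb.
split; apply/eqP.
  by rewrite -(eqn_pmul2l a10) EC' Ea.
by rewrite -(eqn_pmul2l b10) ED' Eb.
Qed.

(** The witnesses are dictated by the decoding lemmas; they satisfy the
    coprimality conditions because N is square-free. *)
Lemma encode_surj N f' m n : (0 < N)%N -> squarefree N -> (f' %| N)%N ->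
  (0 < gcdn m n)%N ->
  let k := gcdn m n in
  exists f w C D, [/\ primitive_row N f C D, (w %| N)%N,
    (f %/ gcdn w f * gcdn w (N %/ f) = f')%N,
    (k * (gcdn w f * C) = m)%N & (k * (gcdn w (N %/ f) * D) = n)%N].
Proof.
move=> N0 sN fN k0 k; set e' := (N %/ f')%N.
have f'0 : (0 < f')%N by apply: dvdn_gt0 fN.
have e'0 : (0 < e')%N by rewrite divn_gt0// dvdn_leq.
have fe : (f' * e' = N)%N by rewrite mulnC divnK.
have cfe : coprime f' e' by exact: squarefree_coprime.
pose m1 := (m %/ k)%N; pose n1 := (n %/ k)%N.
have mE : (m1 * k = m)%N by rewrite divnK// dvdn_gcdl.
have nE : (n1 * k = n)%N by rewrite divnK// dvdn_gcdr.
have cmn : coprime m1 n1.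
  by rewrite /coprime -(eqn_pmul2r k0) mul1n muln_gcdl mE nE.
pose a := gcdn m1 e'; pose b := gcdn n1 f'.
have ae : (a %| e')%N by exact: dvdn_gcdr.
have bf : (b %| f')%N by exact: dvdn_gcdr.
have am : (a %| m1)%N by exact: dvdn_gcdl.
have bn : (b %| n1)%N by exact: dvdn_gcdl.
have a0 : (0 < a)%N by rewrite gcdn_gt0 e'0 orbT.
have b0 : (0 < b)%N by rewrite gcdn_gt0 f'0 orbT.
have sf : squarefree f' by exact: squarefree_dvd fN.
have se : squarefree e' by apply: squarefree_dvd sN _; rewrite -fe dvdn_mull.
have cem : coprime (e' %/ a) m1 by exact: squarefree_coprime_quot.
have cfn : coprime (f' %/ b) n1 by exact: squarefree_coprime_quot.
have cfb : coprime (f' %/ b) b by exact: coprime_dvdr cfn.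
have cea : coprime (e' %/ a) a by exact: coprime_dvdr cem.
pose f := (f' %/ b * a)%N; pose e := (e' %/ a * b)%N.
have fef : (f * e = N)%N.
  by rewrite /f /e -fe -{2}(divnK bf) -{2}(divnK ae); ring.
have f0 : (0 < f)%N by rewrite muln_gt0 divn_gt0// dvdn_leq.
have eE : (N %/ f = e)%N by rewrite -fef mulKn.
have gf : gcdn (a * b) f = a.
  by rewrite /f [(_ * a)%N]mulnC -muln_gcdr gcdnC (eqP cfb) muln1.
have ge : gcdn (a * b) e = b.
  by rewrite /e [(a * b)%N]mulnC [(_ * b)%N]mulnC -muln_gcdr gcdnC (eqP cea) muln1.
exists f, (a * b)%N, (m1 %/ a)%N, (n1 %/ b)%N; rewrite eE gf ge; split.
- rewrite /primitive_row -{1}fef dvdn_mulr//= eE /e /f.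
  rewrite -(mulnA _ b) (mulnC b) divnK// -(mulnA _ a) (mulnC a) divnK//.
  rewrite coprimeMl !coprimeMr [coprime n1 m1]coprime_sym cmn.
  rewrite [coprime n1 _]coprime_sym cfn cem andbT /=.
  by rewrite andbT coprime_sym; apply: coprime_dvdl (dvdn_div bf) _; apply: coprime_dvdr (dvdn_div ae) _.
- by rewrite -fe mulnC dvdn_mul.
- by rewrite /f mulnK// divnK.
- by rewrite [(a * _)%N]mulnC divnK// mulnC.
- by rewrite [(b * _)%N]mulnC divnK// mulnC.
Qed.

(** (N/f1) D1^2 = (N/f2) D2^2 and D2 prime to f2 make N/f1 divide N/f2, and
    symmetrically. *)
Lemma primitive_row_level N f1 C1 D1 f2 C2 D2 : (0 < N)%N ->
  primitive_row N f1 C1 D1 -> primitive_row N f2 C2 D2 ->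
  (N %/ f1 * D1 ^ 2 = N %/ f2 * D2 ^ 2)%N -> f1 = f2.
Proof.
move=> N0.
have key g1 B1 A1 g2 B2 A2 : primitive_row N g1 B1 A1 -> primitive_row N g2 B2 A2 ->
  (N %/ g1 * A1 ^ 2 = N %/ g2 * A2 ^ 2)%N -> (N %/ g1 %| N %/ g2)%N.
  move=> /andP[gN1 _] /andP[gN2 cp] E.
  have c2 : coprime (A2 ^ 2) g2.
    apply: coprimeXl; apply: coprime_dvdl (coprime_dvdr _ cp); first exact: dvdn_mull.
    exact: dvdn_mulr.
  rewrite -[X in (_ %| X)%N]muln1 -(eqP c2) muln_gcdr dvdn_gcd -E dvdn_mulr//=.
  by rewrite divnK// dvdn_div.
move=> p1 p2 E; have E' := esym E.
have H1 := key _ _ _ _ _ _ p1 p2 E; have H2 := key _ _ _ _ _ _ p2 p1 E'.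
have /eqP Ee : (N %/ f1 == N %/ f2)%N by rewrite eqn_dvd H1 H2.
have fN1 := proj1 (andP p1); have fN2 := proj1 (andP p2).
have f10 : (0 < N %/ f1)%N by rewrite divn_gt0 ?(dvdn_gt0 N0 fN1)// dvdn_leq.
by apply/eqP; rewrite -(eqn_pmul2l f10) divnK// Ee divnK.
Qed.

End Arithmetic.

(** * Normal form of the matrices and of the cosets *)

Section Matrices.
Variables (R : realType) (N : nat).
Hypothesis N0 : (0 < N)%N.
Implicit Types (f : nat) (a b c d t : int) (g h : 'M[R]_2).

Lemma mx22_mul (a b c d a' b' c' d' : R) :
  mx22 a b c d *m mx22 a' b' c' d' =
  mx22 (a * a' + b * c') (a * b' + b * d') (c * a' + d * c') (c * b' + d * d').
Proof.
apply/matrixP => i j; rewrite !mxE !big_ord_recl big_ord0 !mxE /= addr0.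
by case: i => [[|[|//]] ?]; case: j => [[|[|//]] ?].
Qed.

Lemma mx22_inj (a b c d a' b' c' d' : R) :
  mx22 a b c d = mx22 a' b' c' d' -> [/\ a = a', b = b', c = c' & d = d'].
Proof.
move/matrixP => H; have := H 0 0; have := H 0 1; have := H 1 0; have := H 1 1.
by rewrite !mxE.
Qed.

(** Atkin-Lehner form: with e = N/f, the element
    e^(-1/2) (e a, b; N c, e d) of the group. *)
Definition nf_mx f a b c d : 'M[R]_2 :=
  let r := Num.sqrt ((N %/ f)%:R) in
  mx22 (r * a%:~R) (b%:~R / r) (r * (f%:R * c%:~R)) (r * d%:~R).

Definition nf_det f a b c d : Prop :=
  (f %| N)%N /\ (N %/ f)%:Z * a * d - b * (f%:Z * c) = 1.

Lemma cofactor_gt0 f : (f %| N)%N -> (0 < N %/ f)%N.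
Proof. by move=> fN; rewrite divn_gt0 ?(dvdn_gt0 N0 fN)// dvdn_leq. Qed.

Lemma sqrt_cofactor_gt0 f : (f %| N)%N -> 0 < Num.sqrt ((N %/ f)%:R : R).
Proof. by move=> fN; rewrite sqrtr_gt0 ltr0n cofactor_gt0. Qed.

Lemma Gamma0plus_nf g : Gamma0plus N g ->
  exists f a b c d, nf_det f a b c d /\ g = nf_mx f a b c d.
Proof.
move=> [a [b [c [d [e [e0 dt eN [/dvdzP[a1 ae] /dvdzP[d1 de] /dvdzP[c1 cN]] ->]]]]]].
case: e e0 dt eN ae de => // e e0 dt eN ae de.
have {}eN : (e %| N)%N by [].
have e0' : (0 < e)%N by [].
have Ne : (N %/ (N %/ e) = e)%N by rewrite divnA// mulKn.
have fN : (N %/ e %| N)%N by rewrite dvdn_div.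
have NE : N%:Z = (N %/ e)%N%:Z * e%:Z by rewrite -PoszM divnK.
exists (N %/ e)%N, a1, b, c1, d1; split.
  split => //; rewrite Ne; apply: (@mulfI _ e%:Z); first by rewrite lt0r_neq0.
  by rewrite mulr1 -[RHS]dt ae de cN NE; ring.
rewrite /nf_mx Ne.
have r0 : 0 < Num.sqrt (e%:R : R) by rewrite sqrtr_gt0 ltr0n.
have rE : (e%:R : R) = Num.sqrt e%:R ^+ 2 by rewrite sqr_sqrtr.
set r := Num.sqrt _ in r0 rE *.
have fE : (N%:R : R) = (N %/ e)%N%:R * e%:R by rewrite -natrM divnK.
apply/matrixP => i j; rewrite !mxE ae de cN !rmorphM /= -!pmulrn fE rE.
rewrite -/r; case: i => [[|[|//]] ?]; case: j => [[|[|//]] ?] /=; by field; rewrite gt_eqF.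
Qed.

Lemma nf_Gamma0plus f a b c d : nf_det f a b c d -> Gamma0plus N (nf_mx f a b c d).
Proof.
move=> [fN dt].
have e0 := cofactor_gt0 fN; set e := (N %/ f)%N in dt e0.
have NE : N%:Z = f%:Z * e%:Z by rewrite -PoszM mulnC divnK.
exists (e%:Z * a), b, (N%:Z * c), (e%:Z * d), e%:Z; split.
- by rewrite ltz_nat.
- by rewrite -[RHS]mulr1 -dt NE; ring.
- by have := dvdn_div fN.
- by split; apply: dvdz_mulr; apply: dvdzz.
rewrite /nf_mx -/e.
have r0 : 0 < Num.sqrt (e%:R : R) by rewrite sqrtr_gt0 ltr0n.
have rE : (e%:R : R) = Num.sqrt e%:R ^+ 2 by rewrite sqr_sqrtr.
have fE : (N%:R : R) = f%:R * e%:R by rewrite -natrM mulnC divnK.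
rewrite -pmulrn; set r := Num.sqrt _ in r0 rE *.
apply/matrixP => i j; rewrite !mxE !rmorphM /= -!pmulrn fE rE.
case: i => [[|[|//]] ?]; case: j => [[|[|//]] ?] /=; by field; rewrite gt_eqF.
Qed.

Lemma nf_primitive f a b c d : nf_det f a b c d -> primitive_row N f (absz c) (absz d).
Proof.
move=> [fN dt]; rewrite /primitive_row fN /=.
have : coprimez ((N %/ f)%:Z * d) (f%:Z * c).
  by apply/coprimezP; exists (a, - b); rewrite /= -dt; ring.
by rewrite /coprimez /gcdz !abszM.
Qed.

Lemma primitive_nf f c d : primitive_row N f (absz c) (absz d) ->
  exists a b, nf_det f a b c d.
Proof.
move=> /andP[fN cp].
have : coprimez ((N %/ f)%:Z * d) (f%:Z * c) by rewrite /coprimez /gcdz !abszM.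
by move=> /coprimezP[[u v] /= uv]; exists u, (- v); split => //; rewrite -uv; ring.
Qed.

Definition translation (s : bool) t : 'M[R]_2 :=
  mx22 ((-1) ^+ s) t%:~R 0 ((-1) ^+ s).

Lemma translation_inf s t : Gamma_inf N (translation s t).
Proof.
split; last by rewrite !mxE.
exists ((-1) ^+ s), t, 0, ((-1) ^+ s), 1; split => //.
- by rewrite mulr0 subr0 -expr2 sqrr_sign.
- by rewrite rmorph1 sqrtr1 invr1 scale1r /translation rmorphXn /= rmorphN1.
Qed.

(** c = 0 turns the determinant condition into e a d = 1 over the integers. *)
Lemma Gamma_inf_translation h : Gamma_inf N h -> exists s t, h = translation s t.
Proof.
move=> [/Gamma0plus_nf[f [a [b [c [d [dt ->]]]]]]].
have fN := proj1 dt; have r0 := sqrt_cofactor_gt0 fN.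
rewrite !mxE /= => /eqP; rewrite !mulf_eq0 (gt_eqF r0) /= pnatr_eq0 gtn_eqF ?(dvdn_gt0 N0 fN)//=.
rewrite intr_eq0 => /eqP c0.
move: (proj2 dt); rewrite c0 !mulr0 subr0 => ad1.
have : absz ((N %/ f)%N%:Z * a * d) == 1%N by rewrite ad1.
rewrite !abszM /= !muln_eq1 => /andP[/andP[/eqP e1 a1] d1].
have {}r0 : Num.sqrt ((N %/ f)%N%:R) = 1 :> R by rewrite e1 sqrtr1.
rewrite e1 mul1r in ad1.
have [ad dE] : a = (-1) ^+ (d < 0)%R /\ d = (-1) ^+ (d < 0)%R.
  have [aE|aE] : a = 1 \/ a = -1 by lia.
    by have dE : d = 1 by [rewrite aE in ad1; lia]; rewrite aE dE.
  by have dE : d = -1 by [rewrite aE in ad1; lia]; rewrite aE dE.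
exists (d < 0)%R, b; rewrite /nf_mx r0 /translation !mulr0 !mul1r divr1 ad {2}dE.
by rewrite !rmorphXn /= !rmorphN1.
Qed.

Lemma translation_nf s t f a b c d : (f %| N)%N ->
  translation s t *m nf_mx f a b c d =
  nf_mx f ((-1) ^+ s * a + t * (f%:Z * c)) ((-1) ^+ s * b + t * ((N %/ f)%:Z * d))
    ((-1) ^+ s * c) ((-1) ^+ s * d).
Proof.
move=> fN; have r0 := sqrt_cofactor_gt0 fN.
rewrite /translation /nf_mx mx22_mul.
have rE : ((N %/ f)%N%:R : R) = Num.sqrt ((N %/ f)%N%:R) ^+ 2 by rewrite sqr_sqrtr.
rewrite !rmorphD !rmorphM !rmorphXn /= !rmorphN1 -!pmulrn.
set r := Num.sqrt _ in r0 rE *.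
congr mx22; rewrite ?rE; by field; rewrite ?gt_eqF.
Qed.

Lemma translation_det s t f a b c d : nf_det f a b c d ->
  nf_det f ((-1) ^+ s * a + t * (f%:Z * c)) ((-1) ^+ s * b + t * ((N %/ f)%:Z * d))
    ((-1) ^+ s * c) ((-1) ^+ s * d).
Proof.
move=> [fN dt]; split => //; rewrite -[RHS]dt.
have := sqrr_sign int s; rewrite expr2; set sg := (-1) ^+ s => ss.
rewrite -[RHS]mul1r -[in RHS]ss; ring.
Qed.

(** Two elements g, g' whose bottom rows agree up to sign differ by an element
    of the stabilizer of the cusp: t is the upper right entry of g' g^-1. *)
Lemma same_row (s : bool) f a b a' b' c d :
  nf_det f a b c d -> nf_det f a' b' ((-1) ^+ s * c) ((-1) ^+ s * d) ->
  exists t, nf_mx f a' b' ((-1) ^+ s * c) ((-1) ^+ s * d) =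
    translation s t *m nf_mx f a b c d.
Proof.
move=> [fN dt] [_ dt']; exists (a * b' - a' * b); rewrite translation_nf//.
have ss := sqrr_sign int s; rewrite expr2 in ss.
set sg := (-1) ^+ s in ss dt' *; set e := (N %/ f)%N%:Z in dt dt' *.
have H1 : b * (f%:Z * c) = e * a * d - 1 by rewrite -dt; ring.
have H2 : b' * (f%:Z * c) = e * a' * d - sg.
  by rewrite -[sg]mulr1 -dt' -[in LHS](mul1r b') -[in LHS]ss -[X in X - _]mul1r -ss; ring.
have H3 : e * a * d = 1 + b * (f%:Z * c) by rewrite H1; ring.
have H4 : e * a' * d = sg + b' * (f%:Z * c) by rewrite H2; ring.
congr nf_mx.
  rewrite (_ : sg * a + _ = sg * a + a * (b' * (f%:Z * c)) - a' * (b * (f%:Z * c))); last by ring.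
  by rewrite H1 H2; ring.
rewrite (_ : sg * b + _ = sg * b + b' * (e * a * d) - b * (e * a' * d)); last by ring.
by rewrite H3 H4; ring.
Qed.

Definition inf_coset g : set 'M[R]_2 := [set h *m g | h in Gamma_inf N].

Lemma inf_coset_eq (s : bool) f a b a' b' c d :
  nf_det f a b c d -> nf_det f a' b' ((-1) ^+ s * c) ((-1) ^+ s * d) ->
  inf_coset (nf_mx f a b c d) = inf_coset (nf_mx f a' b' ((-1) ^+ s * c) ((-1) ^+ s * d)).
Proof.
have sub (s1 : bool) f1 a1 b1 a2 b2 c1 d1 :
  nf_det f1 a1 b1 c1 d1 -> nf_det f1 a2 b2 ((-1) ^+ s1 * c1) ((-1) ^+ s1 * d1) ->
  inf_coset (nf_mx f1 a2 b2 ((-1) ^+ s1 * c1) ((-1) ^+ s1 * d1)) `<=` inf_coset (nf_mx f1 a1 b1 c1 d1).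
  move=> dt1 dt2 _ [h /Gamma_inf_translation[s2 [t ->]] <-].
  rewrite translation_nf; last by case: dt1.
  have := translation_det s2 t dt2.
  set a3 := _ + _ ; set b3 := _ + _ ; rewrite !mulrA -!signr_addb => dt3.
  have [t' ->] := same_row dt1 dt3.
  by exists (translation (s2 (+) s1) t') => //; exact: translation_inf.
move=> dt dt'; apply/seteqP; split; last exact: sub.
have E x : x = (-1) ^+ s * ((-1) ^+ s * x) :> int by rewrite signrMK.
rewrite [X in nf_mx f a b X](E c) [X in nf_mx f a b _ X](E d); apply: sub => //.
by rewrite -!E.
Qed.

Lemma absz_sqr d : ((absz d) ^ 2)%:R = d%:~R ^+ 2 :> R.
Proof. by case: d => n /=; rewrite natrX // NegzE rmorphN /= sqrrN. Qed.

(** The squares of the entries d determine the level by primitive_row_level;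
    the square roots then cancel. *)
Lemma nf_row_unique (s : bool) f1 c1 d1 f2 c2 d2 :
  primitive_row N f1 (absz c1) (absz d1) -> primitive_row N f2 (absz c2) (absz d2) ->
  let r1 := Num.sqrt ((N %/ f1)%N%:R) : R in let r2 := Num.sqrt ((N %/ f2)%N%:R) : R in
  r1 * (f1%:R * c1%:~R) = (-1) ^+ s * (r2 * (f2%:R * c2%:~R)) ->
  r1 * d1%:~R = (-1) ^+ s * (r2 * d2%:~R) ->
  [/\ f1 = f2, c1 = (-1) ^+ s * c2 & d1 = (-1) ^+ s * d2].
Proof.
move=> p1 p2 r1 r2 Ec Ed.
have r1E : r1 ^+ 2 = (N %/ f1)%N%:R by rewrite sqr_sqrtr.
have r2E : r2 ^+ 2 = (N %/ f2)%N%:R by rewrite sqr_sqrtr.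
have E : f1 = f2.
  apply: (primitive_row_level N0 p1 p2); apply/eqP; rewrite -(eqr_nat R) natrM [X in _ == X]natrM !absz_sqr.
  rewrite -r1E -r2E -[X in X == _]exprMn Ed -[X in _ == X]exprMn.
  by rewrite [X in X == _]exprMn sqrr_sign mul1r.
have f1N := proj1 (andP p1).
have r10 : r1 != 0 by rewrite gt_eqF// sqrt_cofactor_gt0.
have f10 : (f1%:R : R) != 0 by rewrite pnatr_eq0 -lt0n (dvdn_gt0 N0 f1N).
rewrite /r2 -E -/r1 in Ec Ed; split => //; apply/eqP; rewrite -(eqr_int R) rmorphM rmorphXn /= rmorphN1.
  apply/eqP/(mulfI f10)/(mulfI r10); rewrite Ec; ring.
by apply/eqP/(mulfI r10); rewrite Ed; ring.
Qed.

(** The chosen representative differs from the defining one by an element of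
    the stabilizer, which changes the bottom row at most by its sign. *)
Lemma coset_repr_nf (k : @cosets R N) : exists f a b c d,
  [/\ nf_det f a b c d, coset_repr (val k) = nf_mx f a b c d &
      val k = inf_coset (nf_mx f a b c d)].
Proof.
have [g /Gamma0plus_nf[f [a [b [c [d [dt gE]]]]]] kE] := set_mem (valP k).
have : val k (coset_repr (val k)).
  apply: xgetPex; rewrite -kE; exists (translation false 0 *m g).
  by exists (translation false 0) => //; exact: translation_inf.
rewrite -{1}kE => -[h /Gamma_inf_translation[s [t ->]]].
rewrite gE translation_nf; last by case: dt.
have dt' := translation_det s t dt => hE.
do 5! eexists; split; first exact: dt'; first by rewrite hE.
by rewrite -(inf_coset_eq dt dt') -kE gE.
Qed.

Lemma Im_moebius f a b c d (z : R[i]) : nf_det f a b c d -> 0 < complex.Im z ->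
  complex.Im (moebius (nf_mx f a b c d) z) =
  complex.Im z / ((N %/ f)%:R * ((f%:R * c%:~R * complex.Re z + d%:~R) ^+ 2 +
     (f%:R * c%:~R * complex.Im z) ^+ 2)).
Proof.
Proof.
move=> [fN dt] y0.
have r0 := sqrt_cofactor_gt0 fN.
have rE : ((N %/ f)%N%:R : R) = Num.sqrt ((N %/ f)%N%:R) ^+ 2 by rewrite sqr_sqrtr.
have dtR : ((N %/ f)%N%:R * a%:~R * d%:~R - b%:~R * (f%:R * c%:~R) : R) = 1.
  by have := congr1 (fun x : int => x%:~R : R) dt; rewrite rmorphB !rmorphM /= -!pmulrn.
rewrite rE in dtR *; set r := Num.sqrt _ in r0 dtR *.
case: z y0 => x y /= y0; rewrite /moebius /nf_mx -/r.
rewrite !mxE /= !mul0r !subr0 !addr0.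
move: dtR; set c' := f%:R * c%:~R; set d' : R := d%:~R; set a' : R := a%:~R; set b' : R := b%:~R => dtR.
have n0 : (c' * x + d') ^+ 2 + (c' * y) ^+ 2 != 0.
  apply/negP; rewrite paddr_eq0 ?sqr_ge0// !sqrf_eq0 => /andP[/eqP dE].
  rewrite mulf_eq0 (gt_eqF y0) orbF => /eqP cE; move: dE dtR.
  by rewrite cE mul0r add0r => ->; rewrite !mulr0 subr0 => /esym/eqP; rewrite oner_eq0.
have r0' : r != 0 by rewrite gt_eqF.
have -> : (r * c' * x + r * d') ^+ 2 + (r * c' * y) ^+ 2 = r ^+ 2 * ((c' * x + d') ^+ 2 + (c' * y) ^+ 2) by ring.
rewrite -[RHS]mulr1 -[X in _ = _ * X]dtR; field.
by rewrite n0 r0'.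
Qed.

End Matrices.

(** * The quadratic forms |f m z + n|^2 / f *)

Section Form.
Context {R : realType}.
Implicit Types (lam x y : R) (f : nat) (v : int * int).

Definition hform lam x y f v : R :=
  lam * ((f%:R * v.1%:~R * x + v.2%:~R) ^+ 2 + (f%:R * v.1%:~R * y) ^+ 2) / f%:R.

Lemma absz_le_supn v : `|v.1%:~R| <= (supn v)%:R :> R /\ `|v.2%:~R| <= (supn v)%:R :> R.
Proof.
by rewrite -!intr_norm !pmulrn !ler_int /supn; split; lia.
Qed.

Lemma absz_twice_halve (m : int) : `|m%:~R - (2 * (m %/ 2)%Z)%:~R| <= 1 :> R.
Proof.
rewrite -rmorphB /= -intr_norm (_ : 1 = 1%:~R)// ler_int.
have := divz_eq m 2; have := modz_ge0 m (isT : (2 : int) != 0).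
have := ltz_pmod m (isT : (0 : int) < 2); lia.
Qed.

(** a^2 - b^2 = (a - b) (2 a - (a - b)). *)
Lemma sqr_dist_le (a b d S : R) : `|a - b| <= d -> `|a| <= S -> d <= S ->
  `|a ^+ 2 - b ^+ 2| <= d * (3 * S).
Proof.
move=> abd aS dS.
have -> : a ^+ 2 - b ^+ 2 = (a - b) * (2 * a - (a - b)) by ring.
rewrite normrM; apply: ler_pM => //; apply: (le_trans (ler_normB _ _)).
by rewrite normrM ger0_norm//; lra.
Qed.

(** m and n are linear combinations of the real and imaginary parts of
    f m z + n, whence the lower bound for a suitable lam; rounding changes
    these parts by a bounded amount. *)
Lemma hform_comparable (N : nat) x y : (0 < N)%N -> 0 < y ->
  exists lam K, 0 < lam /\ comparable_form N (hform lam x y) K.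
Proof.
(* With A + i B = f m z + n one has m^2 <= B^2 / y^2 and
   n^2 <= 2 A^2 + 2 (x/y)^2 B^2; the factor N makes up for the division by f. *)
move=> N0 y0; pose lam := N%:R * (2 + 2 * (x / y) ^+ 2 + (y ^+ 2)^-1).
have NR : 0 < N%:R :> R by rewrite ltr0n.
have y2 : 0 < y ^+ 2 by rewrite exprn_gt0.
have xy2 : 0 <= (x / y) ^+ 2 by exact: sqr_ge0.
have iy2 : 0 < (y ^+ 2)^-1 by rewrite invr_gt0.
have lam0 : 0 < lam by rewrite mulr_gt0//; lra.
exists lam, (lam * (3 * ((N%:R * `|x| + 1) ^+ 2 + (N%:R * y) ^+ 2))); split => //; split.
- move=> f v fN; have f0 : (0 < f)%N by apply: dvdn_gt0 fN.
  have F0 : 0 < f%:R :> R by rewrite ltr0n.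
  have F1 : 1 <= f%:R :> R by rewrite ler1n.
  have FN : f%:R <= N%:R :> R by rewrite ler_nat dvdn_leq.
  rewrite /hform; set m : R := v.1%:~R; set n : R := v.2%:~R.
  set A := f%:R * m * x + n; set B := f%:R * m * y.
  have A2 : 0 <= A ^+ 2 by exact: sqr_ge0.
  have B2 : 0 <= B ^+ 2 by exact: sqr_ge0.
  suff H : (supn v)%:R ^+ 2 <= (2 + 2 * (x / y) ^+ 2 + (y ^+ 2)^-1) * (A ^+ 2 + B ^+ 2).
    apply: (le_trans H); rewrite ler_pdivlMr// mulrC /lam -[X in _ <= X]mulrA.
    by apply: ler_pM => //; rewrite mulr_ge0//; lra.
  have mB : m ^+ 2 <= (y ^+ 2)^-1 * B ^+ 2.
    have -> : (y ^+ 2)^-1 * B ^+ 2 = f%:R ^+ 2 * m ^+ 2 by rewrite /B; field; rewrite gt_eqF.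
    by rewrite -[X in X <= _]mul1r ler_wpM2r ?sqr_ge0// exprn_ege1.
  have nAB : n ^+ 2 <= 2 * A ^+ 2 + 2 * (x / y) ^+ 2 * B ^+ 2.
    have -> : n = A - (x / y) * B by rewrite /A /B; field; rewrite gt_eqF.
    have : 0 <= (A + (x / y) * B) ^+ 2 by exact: sqr_ge0.
    have -> : 2 * A ^+ 2 + 2 * (x / y) ^+ 2 * B ^+ 2 =
      (A - (x / y) * B) ^+ 2 + (A + (x / y) * B) ^+ 2 by ring.
    by rewrite lerDl.
  have XA : 0 <= (x / y) ^+ 2 * A ^+ 2 by rewrite mulr_ge0.
  have YA : 0 <= (y ^+ 2)^-1 * A ^+ 2 by rewrite mulr_ge0// ltW.
  have XB : 0 <= (x / y) ^+ 2 * B ^+ 2 by rewrite mulr_ge0.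
  have YB : 0 <= (y ^+ 2)^-1 * B ^+ 2 by rewrite mulr_ge0// ltW.
  have -> : (2 + 2 * (x / y) ^+ 2 + (y ^+ 2)^-1) * (A ^+ 2 + B ^+ 2) =
    2 * A ^+ 2 + 2 * B ^+ 2 + 2 * ((x / y) ^+ 2 * A ^+ 2) + 2 * ((x / y) ^+ 2 * B ^+ 2)
    + (y ^+ 2)^-1 * A ^+ 2 + (y ^+ 2)^-1 * B ^+ 2 by ring.
  have -> : (supn v)%:R ^+ 2 = Num.max (m ^+ 2) (n ^+ 2) :> R.
    rewrite -!absz_sqr -!natrX /supn maxEle ler_nat leq_sqr.
    by case: leqP.
  by rewrite ge_max; apply/andP; split; lra.
- move=> f v fN; have f0 : (0 < f)%N by apply: dvdn_gt0 fN.
  rewrite /hform /twice /= !rmorphM /=; field.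
  by rewrite pnatr_eq0 -lt0n.
- clearbody lam; move=> f v fN; have f0 : (0 < f)%N by apply: dvdn_gt0 fN.
  have F0 : 0 < f%:R :> R by rewrite ltr0n.
  have F1 : 1 <= f%:R :> R by rewrite ler1n.
  have FN : f%:R <= N%:R :> R by rewrite ler_nat dvdn_leq.
  have [v0|v0] := eqVneq v (0, 0).
    by rewrite v0 (_ : twice (halve (0, 0)) = (0, 0))// subrr normr0 mulr0.
  have S1 : 1 <= (supn v)%:R :> R by rewrite ler1n supn_gt0.
  have [mS nS] := absz_le_supn v.
  have md := absz_twice_halve v.1; have nd := absz_twice_halve v.2.
  rewrite /hform /twice /halve /=.
  set m : R := v.1%:~R in mS md *; set n : R := v.2%:~R in nS nd *.
  set m' : R := (2 * _)%:~R in md *; set n' : R := (2 * (v.2 %/ 2)%Z)%:~R in nd *.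
  set S : R := (supn v)%:R in S1 mS nS *.
  set A := f%:R * m * x + n; set B := f%:R * m * y.
  set A' := f%:R * m' * x + n'; set B' := f%:R * m' * y.
  pose dA := f%:R * `|x| + 1; pose dB := f%:R * y.
  have dA0 : 0 <= dA by rewrite addr_ge0// mulr_ge0// ltW.
  have dB0 : 0 <= dB by rewrite mulr_ge0// ltW.
  have fx0 : 0 <= f%:R * `|x| by rewrite mulr_ge0// ltW.
  have dAb : `|A - A'| <= dA.
    have -> : A - A' = (m - m') * (f%:R * x) + (n - n') by rewrite /A /A'; ring.
    apply: (le_trans (ler_normD _ _)); apply: lerD => //.
    rewrite normrM [X in _ * X]normrM (ger0_norm (ltW F0)).
    by rewrite -[X in _ <= X]mul1r ler_wpM2r.
  have dBb : `|B - B'| <= dB.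
    have -> : B - B' = (m - m') * dB by rewrite /B /B' /dB; ring.
    by rewrite normrM (ger0_norm dB0) -[X in _ <= X]mul1r ler_wpM2r.
  have Ab : `|A| <= dA * S.
    apply: (le_trans (ler_normD _ _)); rewrite mulrDl mul1r lerD//.
    rewrite -mulrA [m * x]mulrC mulrA normrM [X in X * _]normrM (ger0_norm (ltW F0)).
    by rewrite ler_wpM2l.
  have Bb : `|B| <= dB * S.
    have -> : B = dB * m by rewrite /B /dB; ring.
    by rewrite normrM (ger0_norm dB0) ler_wpM2l.
  have H1 := sqr_dist_le dAb Ab; have H2 := sqr_dist_le dBb Bb.
  have {}H1 : `|A ^+ 2 - A' ^+ 2| <= dA * (3 * (dA * S)) by apply: H1; rewrite ler_peMr.
  have {}H2 : `|B ^+ 2 - B' ^+ 2| <= dB * (3 * (dB * S)) by apply: H2; rewrite ler_peMr.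
  have -> : lam * (A ^+ 2 + B ^+ 2) / f%:R - lam * (A' ^+ 2 + B' ^+ 2) / f%:R =
    lam * ((A ^+ 2 - A' ^+ 2) + (B ^+ 2 - B' ^+ 2)) / f%:R by ring.
  rewrite normrM normrM (gtr0_norm lam0) normfV (gtr0_norm F0).
  rewrite ler_pdivrMr// -!mulrA ler_pM2l//.
  apply: (le_trans (ler_normD _ _)); apply: (le_trans (lerD H1 H2)).
  have dAN : dA ^+ 2 <= (N%:R * `|x| + 1) ^+ 2.
    apply: lerXn2r; [by rewrite nnegrE|by rewrite nnegrE addr_ge0// mulr_ge0// ltW|].
    by rewrite lerD2r ler_wpM2r.
  have dBN : dB ^+ 2 <= (N%:R * y) ^+ 2.
    apply: lerXn2r; [by rewrite nnegrE|by rewrite nnegrE mulr_ge0// ltW|].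
    by rewrite ler_wpM2r// ltW.
  have -> : dA * (3 * (dA * S)) + dB * (3 * (dB * S)) = 3 * (dA ^+ 2 + dB ^+ 2) * S by ring.
  rewrite -mulrA; apply: ler_wpM2l => //; apply: ler_pM.
  - by rewrite addr_ge0// sqr_ge0.
  - by apply: le_trans S1.
  - exact: lerD.
  - by rewrite ler_peMr// (le_trans _ S1).
Qed.

Lemma hform_upper lam x y v : 0 < lam ->
  hform lam x y 1 v <= lam * ((`|x| + 1) ^+ 2 + y ^+ 2) * (supn v)%:R ^+ 2.
Proof.
move=> lam0; rewrite /hform divr1 !mul1r -mulrA ler_pM2l//.
have [mS nS] := absz_le_supn v.
set S : R := (supn v)%:R in mS nS *; set m : R := v.1%:~R in mS *; set n : R := v.2%:~R in nS *.
rewrite mulrDl -!exprMn; apply: lerD.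
  rewrite -real_normK ?num_real// lerXn2r ?nnegrE ?mulr_ge0// ?addr_ge0//; last first.
  apply: (le_trans (ler_normD _ _)); rewrite mulrDl mul1r lerD//.
  by rewrite normrM mulrC ler_wpM2l.
rewrite -real_normK ?num_real// -[X in _ <= X]real_normK ?num_real//.
rewrite lerXn2r ?nnegrE// !normrM mulrC ler_wpM2l//.
exact: le_trans (ler_norm _).
Qed.

(** a and b rescale the form and the level so that only the product a b
    survives. *)
Lemma hform_encode lam x y (a b f : nat) (u c d : int) :
  (0 < f)%N -> (0 < b)%N -> (a %| f)%N ->
  hform lam x y (f %/ a * b) (u * (a%:Z * c), u * (b%:Z * d)) =
  u%:~R ^+ 2 * (a * b)%:R * hform lam x y f (c, d).
Proof.
move=> f0 b0 af; have a0 : (0 < a)%N by apply: dvdn_gt0 af.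
have qE : ((f %/ a)%N%:R : R) = f%:R / a%:R.
  by rewrite -{2}(divnK af) natrM mulfK// pnatr_eq0 -lt0n.
rewrite /hform /= !rmorphM /= -!pmulrn ?natrM qE; field.
by rewrite !pnatr_eq0 -!lt0n f0 a0 b0.
Qed.

End Form.

(** * Rows of cosets *)

Section Rows.
Variables (R : realType) (N : nat).
Hypotheses (N0 : (0 < N)%N) (sN : squarefree N).

(** r = (f, (c, d)) describes the bottom row of the representative that the
    Eisenstein series uses for the coset k. *)
Definition row_of (k : @cosets R N) (r : nat * (int * int)) : Prop :=
  exists a b, [/\ nf_det N r.1 a b r.2.1 r.2.2,
    coset_repr (val k) = nf_mx R N r.1 a b r.2.1 r.2.2 &
    val k = inf_coset N (nf_mx R N r.1 a b r.2.1 r.2.2)].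

Lemma row_of_primitive k r : row_of k r ->
  primitive_row N r.1 (absz r.2.1) (absz r.2.2).
Proof. by move=> [a [b [/nf_primitive]]]. Qed.

Lemma row_of_admissible k r : row_of k r -> admissible N r.
Proof.
case: r => f [c d] /row_of_primitive /andP[/= fN cp]; rewrite /admissible fN /=.
by apply: contraTneq cp => -[-> ->]; rewrite !muln0.
Qed.

Lemma row_of_inj (s : bool) k1 k2 f c d :
  row_of k1 (f, (c, d)) -> row_of k2 (f, ((-1) ^+ s * c, (-1) ^+ s * d)) -> k1 = k2.
Proof.
move=> [a1 [b1 [/= dt1 _ E1]]] [a2 [b2 [/= dt2 _ E2]]].
by apply: val_inj; apply: (etrans E1); rewrite (@inf_coset_eq R N N0 _ _ _ _ _ _ _ _ dt1 dt2).
Qed.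

Lemma row_of_exists k : exists r, row_of k r.
Proof.
have [f [a [b [c [d [dt E1 E2]]]]]] := coset_repr_nf N0 k.
by exists (f, (c, d)), a, b.
Qed.

Lemma row_of_unique k r f a b c d : row_of k r -> nf_det N f a b c d ->
  val k = inf_coset N (nf_mx R N f a b c d) ->
  exists s : bool, r = (f, ((-1) ^+ s * c, (-1) ^+ s * d)).
Proof.
case: r => f0 [c0 d0] kr dt kE.
have [a0 [b0 [dt0 _ E0]]] := kr; rewrite [(_, _).1]/= [(_, _).2]/= in dt0 E0.
have : val k (nf_mx R N f0 a0 b0 c0 d0).
  rewrite E0; exists (translation R false 0); first exact: translation_inf.
  by rewrite (translation_nf R N0 _ _ _ _ _ _ (proj1 dt0)) expr0 !mul1r !mul0r !addr0.
rewrite kE => -[h /(Gamma_inf_translation N0)[s [t ->]]].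
rewrite (translation_nf R N0 _ _ _ _ _ _ (proj1 dt)) => /mx22_inj[_ _ Ec Ed].
exists s; have [] := @nf_row_unique R N N0 s f0 c0 d0 f c d (nf_primitive dt0) (nf_primitive dt).
- by rewrite -Ec rmorphM rmorphXn /= rmorphN1; ring.
- by rewrite -Ed rmorphM rmorphXn /= rmorphN1; ring.
by move=> -> -> ->.
Qed.

(** p = ((k, w), s) stands for the integer k + 1, the divisor w and the sign
    (-1)^s. *)
Definition encode (r : nat * (int * int)) (p : (nat * nat) * bool) : nat * (int * int) :=
  let a := gcdn p.1.2 r.1 in let b := gcdn p.1.2 (N %/ r.1) in
  let u : int := (-1) ^+ p.2 * p.1.1.+1%:Z in
  ((r.1 %/ a * b)%N, (u * (a%:Z * r.2.1), u * (b%:Z * r.2.2))).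

Lemma encode_admissible k r p : row_of k r -> (p.1.2 %| N)%N -> admissible N (encode r p).
Proof.
case: r => f [c d] kr; case: p => [[k' w] s] /= wN.
have pr := row_of_primitive kr.
rewrite /admissible /encode /= (encode_dvd N0 sN pr wN) /=.
have /andP[/= _ rc0] := row_of_admissible kr.
have [[f0 e0 a0 b0] _] := encode_facts N0 sN pr wN.
apply: contraNneq rc0 => -[/eqP + /eqP].
rewrite !mulf_eq0 signr_eq0 /= !eqz_nat !gtn_eqF//= => /eqP -> /eqP ->.
by [].
Qed.

(** encode_inj settles the absolute values.  The remaining common sign of
    (c, d) shows that the cosets agree, then that the signs of p1 and p2 do. *)
Lemma encode_injective k1 k2 r1 r2 p1 p2 : row_of k1 r1 -> row_of k2 r2 ->
  (k1 = k2 -> r1 = r2) -> (p1.1.2 %| N)%N -> (p2.1.2 %| N)%N ->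
  encode r1 p1 = encode r2 p2 -> k1 = k2 /\ p1 = p2.
Proof.
case: r1 => f1 [c1 d1]; case: p1 => [[n1 w1] s1]; case: r2 => f2 [c2 d2]; case: p2 => [[n2 w2] s2].
move=> kr1 kr2 rE /= wN1 wN2; rewrite /encode /= => -[Ef Ec Ed].
have pr1 : primitive_row N f1 (absz c1) (absz d1) := row_of_primitive kr1.
have pr2 : primitive_row N f2 (absz c2) (absz d2) := row_of_primitive kr2.
have [[_ _ a10 b10] _] := encode_facts N0 sN pr1 wN1.
have /(congr1 absz) := Ec; have /(congr1 absz) := Ed.
rewrite !abszM !abszX /= !exp1n !mul1n => Ed' Ec'.
have [[nE] wE fE [cE dE]] := encode_inj N0 sN (ltn0Sn n1) (ltn0Sn n2) pr1 pr2 wN1 wN2 Ef Ec' Ed'.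
subst f2 w2 n2.
have cancel_ (s s' : bool) (m : nat) (x y : int) : (0 < m)%N ->
    (-1) ^+ s * n1.+1%:Z * (m%:Z * x) = (-1) ^+ s' * n1.+1%:Z * (m%:Z * y) ->
    y = (-1) ^+ (s (+) s') * x.
  move=> m0 E; have nm : n1.+1%:Z * m%:Z != 0 by rewrite -PoszM eqz_nat -lt0n muln_gt0.
  apply: (mulfI nm); rewrite signr_addb -(signrMK s' (n1.+1%:Z * m%:Z * y)).
  rewrite (_ : (-1) ^+ s' * (_ * y) = (-1) ^+ s' * n1.+1%:Z * (m%:Z * y)); last by ring.
  by rewrite -E; ring.
have {}Ec := cancel_ _ _ _ _ _ a10 Ec; have {}Ed := cancel_ _ _ _ _ _ b10 Ed.
have kE : k1 = k2 by apply: (row_of_inj (s := s1 (+) s2) kr1); rewrite -Ec -Ed.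
split => //; congr (_, _).
have [_ cc dd] : [/\ f1 = f1, c1 = c2 & d1 = d2] by have := rE kE => -[].
rewrite -cc -dd in Ec Ed.
have := proj2 (andP (row_of_admissible kr1)).
have [//|] := eqVneq s1 s2; rewrite negb_eqb => ss rc0; case/eqP: rc0.
rewrite ss expr1 mulN1r in Ec Ed.
by congr (_, _); lia.
Qed.

(** encode_surj gives a primitive row in absolute values; restore the signs
    and complete it to a matrix.  The row chosen for its coset may be the
    opposite one, which the sign in p compensates. *)
Lemma encode_surjective (row : @cosets R N -> nat * (int * int)) j :
  (forall k, row_of k (row k)) -> admissible N j ->
  exists k p, (p.1.2 %| N)%N /\ encode (row k) p = j.
Proof.
case: j => f [m n] rowP /andP[/= fN mn0].
have g0 : (0 < gcdn (absz m) (absz n))%N.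
  by rewrite gcdn_gt0 !absz_gt0 -negb_and; apply: contraNN mn0 => /andP[/eqP -> /eqP ->].
have [f1 [w [C [D [pr wN fE mE nE]]]]] := encode_surj N0 sN fN g0.
have [[_ _ a0 b0] _] := encode_facts N0 sN pr wN.
set g := gcdn _ _ in g0 mE nE.
pose c : int := (-1) ^+ (m < 0)%R * C%:Z; pose d : int := (-1) ^+ (n < 0)%R * D%:Z.
have pr' : primitive_row N f1 (absz c) (absz d) by rewrite !abszMsign.
have [a1 [b1 dt]] := primitive_nf pr'.
have kin : inf_coset N (nf_mx R N f1 a1 b1 c d) \in @cosets R N.
  by apply/mem_set; exists (nf_mx R N f1 a1 b1 c d) => //; exact: nf_Gamma0plus.
pose k : @cosets R N :=
  @exist _ (fun x => x \in @cosets R N) _ kin.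
have [s rE] := row_of_unique (rowP k) dt erefl.
exists k, ((g.-1, w), s); split => //.
rewrite rE /encode /= fE prednK//.
have ss : (-1) ^+ s * (-1) ^+ s = 1 :> int by rewrite -expr2 sqrr_sign.
congr (_, (_, _)).
  rewrite [RHS]intEsign -mE /c !PoszM -[RHS]mul1r -[X in _ = X * _]ss; ring.
rewrite [RHS]intEsign -nE /d !PoszM -[RHS]mul1r -[X in _ = X * _]ss; ring.
Qed.

End Rows.

(** * Unfolding the lattice sum into the Eisenstein series *)

Section Unfolding.
Variables (R : realType) (N : nat) (z : R[i]) (lam K : R).
Hypotheses (N0 : (0 < N)%N) (sN : squarefree N) (z0 : 0 < complex.Im z) (lam0 : 0 < lam).
Let q := hform lam (complex.Re z) (complex.Im z).
Hypothesis qK : comparable_form N q K.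
Let c0 := complex.Im z * lam / N%:R.

Definition height (k : @cosets R N) : R :=
  complex.Im (moebius (coset_repr (val k)) z).

Lemma height_row k r : row_of k r -> height k = (complex.Im z * lam / N%:R) / q r.1 r.2.
Proof.
case: r => f [c d] kr; have := form_ge1 qK (row_of_admissible kr); move: kr => [a [b [/= dt kE _]]] q1.
have fN := proj1 dt; have e0 := cofactor_gt0 N0 fN; have f0 := dvdn_gt0 N0 fN.
rewrite /height kE (Im_moebius N0 dt z0).
have q0 : q f (c, d) != 0 by rewrite gt_eqF// (lt_le_trans _ q1).
rewrite /q /hform /= in q0 *.
have NE : (N%:R : R) = (N %/ f)%N%:R * f%:R by rewrite -natrM divnK.
move: q0; set T := _ + _; rewrite !mulf_eq0 !negb_or NE => /andP[/andP[l0 T0] _].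
by field; rewrite l0 T0 !pnatr_eq0 -!lt0n f0 e0.
Qed.

Lemma form_encode (k : @cosets R N) r p : row_of k r -> (p.1.2 %| N)%N ->
  q (encode N r p).1 (encode N r p).2 = (p.1.1.+1 ^ 2 * p.1.2)%:R * q r.1 r.2.
Proof.
case: r => f [c d] kr; case: p => [[k' w] s] /= wN.
have [[f0 e0 a0 b0] [af be fe ab]] := encode_facts N0 sN (row_of_primitive kr) wN.
rewrite /q /encode /= hform_encode// ab natrM natrX rmorphM rmorphXn /= rmorphN1.
by rewrite exprMn sqrr_sign mul1r -pmulrn.
Qed.

(** Sum over the fibres of the encoding: a vector encoded by the coset k and
    ((j, w), s) contributes the height of k times a term of Z, and the sign
    accounts for the factor 2. *)
Lemma unfold_sum s S Z :
  has_sum ((lattice_term N q)^~ s) S -> has_sum ((zeta_term N)^~ s) Z -> 0 < Z ->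
  exists l, has_sum (fun k : @cosets R N => height k `^ s) l /\
    S = 2 * c0 `^ (- s) * Z * l.
Proof.
move=> HS HZ Z0.
have c00 : 0 < c0 by rewrite divr_gt0 ?mulr_gt0// ltr0n.
have [|row rowP] := @choice _ _ (@row_of R N).
  by move=> k; exact: row_of_exists.
have pw k : q (row k).1 (row k).2 `^ (- s) = c0 `^ (- s) * height k `^ s.
  have q1 := form_ge1 qK (row_of_admissible (rowP k)).
  have q0 : 0 <= q (row k).1 (row k).2 by apply: le_trans q1.
  rewrite (height_row (rowP k)) -/q -/c0.
  rewrite powRM ?invr_ge0 ?(ltW c00)// mulrA [X in X * _]mulrC.
  rewrite [c0 `^ (- s)]powRN mulfV ?gt_eqF ?powR_gt0// mul1r.
  by rewrite -(powR_inv1 q0) -powRrM mulN1r.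
(* On D the map phi is a bijection onto the admissible vectors. *)
pose D (i : @cosets R N * ((nat * nat) * bool)) := (i.2.1.2 %| N)%N.
pose phi i := encode N (row i.1) i.2.
have gE i : (if D i then lattice_term N q (phi i) s else 0) =
   c0 `^ (- s) * height i.1 `^ s * (zeta_term N i.2.1 s * 1).
  rewrite /D /zeta_term; case: ifPn => Di; last by rewrite mul0r mulr0.
  rewrite /lattice_term (encode_admissible N0 sN (rowP _) Di).
  rewrite (form_encode (rowP _) Di).
  have q1 := form_ge1 qK (row_of_admissible (rowP i.1)).
  rewrite powRM//; last by apply: le_trans q1.
  by rewrite -/q pw mulr1 mulrC.
have phiI : {in D &, injective phi}.
  move=> [k1 p1] [k2 p2]; rewrite /D => /= D1 D2 E.
  have rE : k1 = k2 -> row k1 = row k2 by move=> ->.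
  by have [/= -> ->] := encode_injective N0 sN (rowP k1) (rowP k2) rE D1 D2 E.
have lat0 j : 0 <= lattice_term N q j s by exact: lattice_term_ge0.
have phiS j : lattice_term N q j s != 0 -> exists2 i, D i & phi i = j.
  rewrite /lattice_term; case: ifPn => [aj _|_]; last by rewrite eqxx.
  have [k [p [pD pj]]] := encode_surjective N0 sN rowP aj.
  by exists (k, p).
(* The vectors encoded with k = w = 1 and one fixed sign already bound the
   sum over the cosets. *)
have [l Hl] : exists l, has_sum (fun k : @cosets R N => height k `^ s) l.
  apply: (@has_sum_bounded _ _ _ (c0 `^ s * S)) => [k|A]; first exact: powR_ge0.
  have E k : height k `^ s = c0 `^ s * lattice_term N q (phi (k, ((0, 1)%N, true))) s.
    have := gE (k, ((0, 1)%N, true)); rewrite /D /zeta_term /= dvd1n => ->.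
    rewrite powR1 !mulr1 mulrA powRN mulfV ?mul1r//.
    by rewrite gt_eqF// powR_gt0.
  rewrite (eq_bigr _ (fun k _ => E k)) -mulr_sumr; apply: ler_wpM2l; first exact: powR_ge0.
  pose B := [fset phi (k, ((0, 1)%N, true)) | k in A]%fset.
  rewrite (_ : \sum_(i <- A) _ = \sum_(j <- B) lattice_term N q j s).
    exact: has_sum_partial_le.
  rewrite /B big_imfset //= => k1 k2 _ _ /phiI.
  by rewrite /in_mem /= /D /= dvd1n => /(_ isT isT) [].
exists l; split => //.
have H1 := has_sum_prod _ _ HZ (@has_sum_bool R).
have H2 : has_sum (fun i : @cosets R N * ((nat * nat) * bool) =>
    c0 `^ (- s) * height i.1 `^ s * (zeta_term N i.2.1 s * 1)) (c0 `^ (- s) * l * (Z * 2)).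
  apply: (has_sum_prod _ _ (has_sumZ Hl) (H1 _ _)) => [k|p|p|b] //.
  - by rewrite mulr_ge0 ?powR_ge0.
  - by rewrite mulr1 /zeta_term; case: ifP => // _; exact: powR_ge0.
  - by rewrite /zeta_term; case: ifP => // _; exact: powR_ge0.
have [H3 _] := @has_sum_reindex _ _ _ D phi _ _ S phiI lat0 phiS (fun i => esym (gE i)).
by rewrite (has_sum_unique (H3 HS) H2); ring.
Qed.

Lemma height_gt0 k : 0 < height k.
Proof.
have [r kr] := row_of_exists N0 k.
rewrite (height_row kr) divr_gt0//.
  by rewrite divr_gt0 ?mulr_gt0// ltr0n.
by apply: lt_le_trans (form_ge1 qK (row_of_admissible kr)).
Qed.

Lemma cpow_real (y s : R) : 0 < y -> cpow y s%:C = (y `^ s)%:C.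
Proof.
move=> y0; rewrite /cpow /= mul0r cos0 sin0 mulr1 mulr0 /powR gt_eqF//.
Qed.

Lemma eisenstein_sum s l : has_sum (fun k : @cosets R N => height k `^ s) l ->
  eisenstein N z s%:C = l%:C.
Proof.
move=> Hl; rewrite /eisenstein /sum.
apply: (@cvg_lim (R[i]^o) (@norm_hausdorff _ (R[i]^o)) _ totally).
apply/cvgrPdist_lt => e e0.
have eE : e = (complex.Re e)%:C.
  by case: e e0 => a b /=; rewrite ltcE /= => /andP[/eqP ->].
have e0' : 0 < complex.Re e by rewrite eE ltcR in e0.
move/cvgrPdist_lt : Hl => /(_ _ e0')[A _ HA]; exists A => // B /= /HA /=.
rewrite !partial_sumE eE => H.
under eq_bigr => k _ do rewrite cpow_real ?height_gt0//.
rewrite -rmorph_sum -rmorphB /= normc_def /= expr0n addr0 sqrtr_sqr ltcR.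
exact: H.
Qed.

End Unfolding.

(** * From complex to real power series *)

Section RealLine.
Context {R : realType}.
Implicit Types (f g : R[i] -> R[i]) (w : R).

Lemma near_real w (P : R[i] -> Prop) : (\forall s \near (w%:C : R[i]^o), P s) ->
  exists r, 0 < r /\ forall t, `|t| < r -> P (w + t)%:C.
Proof.
move=> /nbhs_ballP[e /= e0 He].
have [eE e0'] : e = (complex.Re e)%:C /\ 0 < complex.Re e.
  by case: e e0 {He} => a b /=; rewrite ltcE /= => /andP[/eqP -> ->].
exists (complex.Re e); split => // t te; apply: He.
rewrite /ball /= -rmorphB /= opprD addrA subrr sub0r normc_def /= expr0n addr0.
by rewrite sqrtr_sqr normrN eE ltcR.
Qed.

Lemma near_real_punctured w (P : R[i] -> Prop) :
  (\forall s \near (w%:C : R[i]^o)^', P s) ->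
  exists r, 0 < r /\ forall t, 0 < `|t| < r -> P (w + t)%:C.
Proof.
move=> H; have [r [r0 Hr]] := @near_real w (fun s => s != w%:C -> P s) H.
exists r; split => // t /andP[t0 tr]; apply: (Hr t tr).
rewrite normr_gt0 in t0; rewrite -subr_eq0 -rmorphB /= addrAC subrr add0r.
by rewrite eq_complex /= eqxx andbT.
Qed.

Lemma cvg_complex_parts (u : nat -> R[i]) (l : R[i]) :
  (u : nat -> R[i]^o) @ \oo --> (l : R[i]^o) ->
  (fun n => complex.Re (u n)) @ \oo --> complex.Re l /\
  (fun n => complex.Im (u n)) @ \oo --> complex.Im l.
Proof.
move=> /cvgrPdist_lt ul.
have H e : 0 < e -> \forall n \near \oo, `|l - u n| < e%:C.
  by move=> e0; apply: ul; rewrite ltcR.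
split; apply/cvgrPdist_lt => e e0; apply: filterS (H e e0) => n;
  rewrite normc_def ltcR; apply: le_lt_trans.
  rewrite -sqrtr_sqr ler_wsqrtr//; case: l {ul H} => a b; case: (u n) => c d /=.
  by rewrite lerDl sqr_ge0.
rewrite -sqrtr_sqr ler_wsqrtr//; case: l {ul H} => a b; case: (u n) => c d /=.
by rewrite lerDr sqr_ge0.
Qed.

Lemma real_analytic_series (w : R) (a : nat -> R) r (h : R -> R) : 0 < r ->
  (forall t, `|t| < r -> series (fun k => a k * t ^+ k) @ \oo --> h (w + t)) ->
  real_analytic h w.
Proof.
move=> r0 H; pose t0 := r / 2; have t00 : 0 < t0 by rewrite divr_gt0.
have t0r : `|t0| < r by rewrite gtr0_norm// /t0; lra.
have /cvg_seq_bounded[B0 [_ HB]] : cvgn (fun k => a k * t0 ^+ k).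
  by apply/cvg_ex; exists 0; apply: cvg_series_cvg_0; apply: cvgP (H t0 t0r).
pose B := B0 + 1.
have aB k : `|a k| <= B * t0^-1 ^+ k.
  rewrite exprVn ler_pdivlMr ?exprn_gt0//.
  rewrite -[X in _ * X](ger0_norm (exprn_ge0 _ (ltW t00))) -normrM.
  by apply: HB => //; rewrite ltrDl.
exists a, (2 * B), (2 * t0^-1); split; first by rewrite mulr_gt0// invr_gt0.
apply: taylor_bound_series; rewrite ?invr_gt0// => t.
rewrite mulrA ler_pdivrMr// mul1r => tt; apply: H.
by rewrite /t0 in tt; lra.
Qed.

(** For real s the coefficients of a complex power series centred at a real
    point split into real and imaginary parts. *)
Lemma analytic_at_real g w : analytic_at g w%:C ->
  real_analytic (fun s => complex.Re (g s%:C)) w /\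
  real_analytic (fun s => complex.Im (g s%:C)) w.
Proof.
move=> [a /near_real[r [r0 Hr]]].
have E t n : series (fun n => a n * ((w + t)%:C - w%:C) ^+ n) n =
   (series (fun n => complex.Re (a n) * t ^+ n) n) +i*
   (series (fun n => complex.Im (a n) * t ^+ n) n).
  have -> : (w + t)%:C - w%:C = t%:C by rewrite -rmorphB /= addrAC subrr add0r.
  elim: n => [|n IH]; first by rewrite /series /= !big_geq.
  rewrite !seriesSr IH -rmorphXn /=; case: (a n) => c d.
  by apply/eqP; rewrite eq_complex /= !mulr0 subr0 add0r !eqxx.
have H t : `|t| < r ->
    series (fun n => complex.Re (a n) * t ^+ n) @ \oo --> complex.Re (g (w + t)%:C) /\
    series (fun n => complex.Im (a n) * t ^+ n) @ \oo --> complex.Im (g (w + t)%:C).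
  move=> /Hr /cvg_complex_parts[H1 H2]; split.
    by apply: cvg_trans H1; apply: near_eq_cvg; apply: nearW => n; rewrite E.
  by apply: cvg_trans H2; apply: near_eq_cvg; apply: nearW => n; rewrite E.
split; apply: (real_analytic_series (w := w) r0) => t /H[H1 H2].
  exact: H1.
exact: H2.
Qed.

Lemma parts_div_real (x : R[i]) (c : R) :
  complex.Re (x / c%:C) = complex.Re x / c /\ complex.Im (x / c%:C) = complex.Im x / c.
Proof. by rewrite -fmorphV /=; case: x => a b /=; rewrite !mulr0 subr0 add0r. Qed.

Lemma meromorphic_real f w : meromorphic_at f w%:C ->
  real_meromorphic (fun s => complex.Re (f s%:C)) w /\
  real_meromorphic (fun s => complex.Im (f s%:C)) w.
Proof.
move=> [k [g [/analytic_at_real[g1 g2] /near_real_punctured[r [r0 Hr]]]]].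
split; [exists k, (fun s => complex.Re (g s%:C)), r|exists k, (fun s => complex.Im (g s%:C)), r];
  split => // t /Hr ->; rewrite -rmorphB /= addrAC subrr add0r -rmorphXn /=.
  by rewrite (proj1 (parts_div_real _ _)).
by rewrite (proj2 (parts_div_real _ _)).
Qed.

End RealLine.

Section Factor.
Context {R : realType}.
Implicit Types (f g : R[i] -> R[i]) (w : R[i]).

(** g2 is g / (s - w)^j, whose value at w has to be set to the coefficient
    a j by hand. *)
Lemma analytic_factor g w (a : nat -> R[i]) j :
  (\forall s \near (w : R[i]^o),
    series (fun n => a n * (s - w) ^+ n : R[i]^o) @ \oo --> (g s : R[i]^o)) ->
  (forall n, (n < j)%N -> a n = 0) ->
  exists g2, [/\ analytic_at g2 w, g2 w = a j &
    \forall s \near (w : R[i]^o)^', g s = g2 s * (s - w) ^+ j].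
Proof.
move=> Hg a0; pose g2 s := if s == w then a j else g s / (s - w) ^+ j.
exists g2; split; rewrite /g2 ?eqxx//; last first.
  have H : \forall s \near (w : R[i]^o)^', s != w by exact: nbhs_dnbhs_neq.
  apply: filterS H => s sw; rewrite (negPf sw) mulfVK// expf_neq0// subr_eq0//.
exists (fun n => a (n + j)%N); apply: filterS Hg => s Hs.
have [->|sw] := eqVneq s w.
  apply: cvg_near_cst; exists 1%N => // n /= n0.
  rewrite /series /= -(prednK n0) big_nat_recl// subrr expr0 mulr1 add0n big1 ?addr0//.
  by move=> i _; rewrite expr0n mulr0.
have sw0 : (s - w) ^+ j != 0 by rewrite expf_neq0// subr_eq0.
have -> : series (fun n => a (n + j)%N * (s - w) ^+ n : R[i]^o) =
   (fun n => series (fun n => a n * (s - w) ^+ n : R[i]^o) (n + j)%N * ((s - w) ^+ j)^-1).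
  apply/funext => n; rewrite /series /= [(n + j)%N]addnC [in RHS](@big_cat_nat _ _ _ j)//= ?leq_addr//.
  rewrite [X in _ = (X + _) * _]big1_seq ?add0r; last first.
    by move=> i /andP[_]; rewrite mem_index_iota => /andP[_ ij]; rewrite a0// mul0r.
  rewrite (_ : \sum_(j <= i < j + n) _ = \sum_(0 <= i < n) a (i + j)%N * (s - w) ^+ (i + j)); last first.
    by rewrite -{1}[j]add0n big_addn addKn.
  rewrite mulr_suml; apply: eq_bigr => i _.
  by rewrite exprD mulrA mulfK.
apply: cvgMr_tmp; rewrite (cvg_shiftn j); exact: Hs.
Qed.

End Factor.

(** * Poles of the Eisenstein series *)

Section Continuation.
Variables (R : realType) (N : nat) (E : R[i] -> R[i] -> R[i]).
Hypotheses (N0 : (0 < N)%N) (sN : squarefree N) (EC : eisenstein_continuation N E).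

(** 4^(1-s) = 1 only for s = 1, as s is real. *)
Lemma doubling_factor_neq0 (s : R) : s != 1 -> 1 - 4 * 4 `^ (- s) != 0.
Proof.
move=> s1; rewrite subr_eq0 eq_sym.
have -> : 4 * 4 `^ (- s) = expR ((1 - s) * ln 4) :> R.
  rewrite powR_expR// -{1}[4](lnK _) ?posrE// -expRD; congr expR; ring.
apply/negP => /eqP; rewrite -[X in _ = X]expR0 => /expR_inj/eqP.
rewrite mulf_eq0 subr_eq0 [1 == s]eq_sym (negPf s1) /= => /eqP ln0.
by have := @ln_gt0 R 4; rewrite ltr1n ln0 ltxx => /(_ isT).
Qed.

Lemma no_pole z (s : R) : 0 < complex.Im z -> 2^-1 < s -> s != 1 ->
  ~ pole_at (E z) s%:C.
Proof.
move=> z0 s2 s1 [k [g [ga gs0 /near_real_punctured[r [r0 Hr]]]]].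
have [lam [K [lam0 qK]]] := hform_comparable (complex.Re z) N0 z0.
have [Z HZ] := @zeta_factor_analytic R N N0.
have [H [Ha HS]] := doubling_sum N0 qK.
have [Emer Eeis] := EC z0.
pose c := complex.Im z * lam / N%:R.
have c0 : 0 < c by rewrite divr_gt0 ?mulr_gt0// ltr0n.
pose P (t : R) := 2 * c `^ (- t) * Z t * (1 - 4 * 4 `^ (- t)).
have Pa w : 2^-1 < w -> real_analytic P w.
  move=> w2; apply: real_analyticM; first apply: real_analyticM; first apply: real_analyticM.
  - exact: real_analytic_cst.
  - exact: real_analytic_powR.
  - by have [] := HZ w w2.
  apply: real_analyticB; first exact: real_analytic_cst.
  by apply: real_analyticM; [exact: real_analytic_cst|exact: real_analytic_powR].
have PE t : 1 < t -> P t * complex.Re (E z t%:C) = H t /\ P t * complex.Im (E z t%:C) = 0.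
  move=> t1; have t2 : 2^-1 < t by lra.
  have [S HSt] := has_sum_lattice N0 qK t1.
  have [HZt Zt0 _] := HZ t t2.
  have [l [Hl SE]] := unfold_sum N0 sN z0 lam0 qK HSt HZt Zt0.
  rewrite Eeis ?ltcR//= (eisenstein_sum N0 z0 lam0 qK Hl) /= mulr0.
  by rewrite (HS t S t1 HSt) SE /P -/c; split => //; ring.
have Ps : P s != 0.
  have [_ Zs _] := HZ s s2.
  rewrite /P !mulf_neq0 ?doubling_factor_neq0//; first by rewrite gt_eqF// powR_gt0.
  by rewrite gt_eqF.
have [gR gI] := analytic_at_real ga.
have poleR : complex.Re (g s%:C) = 0.
  apply: (@pole_numerator_eq0 _ (fun t => complex.Re (E z t%:C)) P H s
     (fun t => complex.Re (g t%:C)) k (Pa s s2) (Ha s s2) gR _ Ps).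
    apply: (@meromorphic_continuation _ _ P H 2^-1) => //.
      by move=> w; have [] := meromorphic_real (Emer w%:C).
    by move=> t /PE[].
  exists r; split => // t /Hr ->.
  rewrite -rmorphB /= addrAC subrr add0r -rmorphXn /=.
  exact: (proj1 (parts_div_real _ _)).
have poleI : complex.Im (g s%:C) = 0.
  apply: (@pole_numerator_eq0 _ (fun t => complex.Im (E z t%:C)) P (fun=> 0) s
     (fun t => complex.Im (g t%:C)) k (Pa s s2) (real_analytic_cst 0 s) gI _ Ps).
    apply: (@meromorphic_continuation _ _ P (fun=> 0) 2^-1) => //.
      by move=> w _; exact: real_analytic_cst.
      by move=> w; have [] := meromorphic_real (Emer w%:C).
    by move=> t /PE[].
  exists r; split => // t /Hr ->.
  rewrite -rmorphB /= addrAC subrr add0r -rmorphXn /=.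
  exact: (proj2 (parts_div_real _ _)).
case/negP: gs0; move: poleR poleI; case: (g s%:C) => a b /= -> ->.
by apply/eqP.
Qed.

(** The lattice sum is E times a factor that is analytic, hence bounded, near
    1; if E were bounded as well, so would be the lattice sum. *)
Lemma Eisenstein_unbounded z : 0 < complex.Im z ->
  ~ exists B r, 0 < r /\ forall t, 1 < t < 1 + r -> `|complex.Re (E z t%:C)| <= B.
Proof.
move=> z0 [B [r [r0 EB]]].
have [lam [K [lam0 qK]]] := hform_comparable (complex.Re z) N0 z0.
have [Z HZ] := @zeta_factor_analytic R N N0.
have [Emer Eeis] := EC z0.
pose c := complex.Im z * lam / N%:R.
have c0 : 0 < c by rewrite divr_gt0 ?mulr_gt0// ltr0n.
pose P (t : R) := 2 * c `^ (- t) * Z t.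
have h1 : 2^-1 < 1 :> R by lra.
have Pa : real_analytic P 1.
  apply: real_analyticM; first apply: real_analyticM.
  - exact: real_analytic_cst.
  - exact: real_analytic_powR.
  - by have [] := HZ 1 h1.
have [M [r' [r'0 PM]]] := real_analytic_bounded Pa.
apply: (lattice_unbounded N0 qK
  (K2 := lam * ((`|complex.Re z| + 1) ^+ 2 + complex.Im z ^+ 2))
  (B := M * B) (r := Num.min r r')).
- by move=> v; exact: hform_upper.
- by rewrite lt_min r0.
move=> s S /andP[s1]; rewrite -ltrBlDl lt_min => /andP[sr sr'] HS.
have s2 : 2^-1 < s by lra.
have [HZs Zs0 _] := HZ s s2.
have [l [Hl ->]] := unfold_sum N0 sN z0 lam0 qK HS HZs Zs0.
have := EB s; rewrite s1 -ltrBlDl sr => /(_ isT).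
rewrite Eeis ?ltcR// (eisenstein_sum N0 z0 lam0 qK Hl) /= => lB.
have := PM (s - 1); rewrite gtr0_norm ?subr_gt0// => /(_ (ltW sr')).
rewrite addrC subrK /P -/c => PB.
apply: (le_trans (ler_norm _)); rewrite normrM; apply: ler_pM => //.
Qed.

(** Divide g / (s - 1)^k by the power of s - 1 dividing g; if no denominator
    were left, E would be bounded near 1. *)
Lemma pole_at_one z : 0 < complex.Im z -> pole_at (E z) 1.
Proof.
move=> z0; have [Emer _] := EC z0.
have [k [g [[a Ha] Hg]]] := Emer 1.
have [j [jk aj a0]] : exists j, [/\ (j <= k)%N, (j < k)%N -> a j != 0 &
    forall n, (n < j)%N -> a n = 0].
  have [[j /andP[jk aj]]|H] := pselect (exists j, (j < k)%N && (a j != 0)).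
    have ex : exists j, (j < k)%N && (a j != 0) by exists j; rewrite jk.
    case: (ex_minnP ex) => i /andP[ik ai] imin; exists i; split=> [||n ni] //.
      exact: ltnW.
    apply/eqP/negP => /negP an; have := imin n.
    by rewrite an (ltn_trans ni ik) leqNgt ni => /(_ isT).
  exists k; split => //; first by rewrite ltnn.
  move=> n nk; apply/eqP/negP => /negP an; apply: H; exists n.
  by rewrite nk.
have [g2 [g2a g21 Hg2]] := analytic_factor Ha a0.
have HE : \forall s \near (1 : R[i]^o)^', E z s = g2 s / (s - 1) ^+ (k - j).
  have H1 : \forall s \near (1 : R[i]^o)^', s != 1 by exact: nbhs_dnbhs_neq.
  near=> s; have s1 : s - 1 != 0 by rewrite subr_eq0; near: s.
  have -> : E z s = g s / (s - 1) ^+ k by near: s.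
  have -> : g s = g2 s * (s - 1) ^+ j by near: s.
  rewrite -{1}(subnK jk) exprD; field.
  by rewrite !expf_neq0.
have := jk; rewrite leq_eqVlt => /predU1P[jkE|jltk]; last first.
  exists (k - j).-1, g2; split => //; first by rewrite g21 aj.
  by rewrite prednK ?subn_gt0.
exfalso; apply: (Eisenstein_unbounded z0).
have [g2R _] := analytic_at_real (w := 1) g2a.
have [M [r [r0 HM]]] := real_analytic_bounded g2R.
have [r' [r'0 Hr']] := near_real_punctured (w := 1) HE.
exists M, (Num.min r r'); rewrite lt_min r0; split => // t /andP[t1].
rewrite -ltrBlDl lt_min => /andP[tr tr'].
have t1E : 1 + (t - 1) = t by ring.
have := Hr' (t - 1); rewrite t1E gtr0_norm ?subr_gt0// t1 tr' => /(_ isT) ->.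
rewrite jkE subnn expr0 divr1.
have := HM (t - 1); rewrite t1E gtr0_norm ?subr_gt0//.
by apply; exact: ltW.
Unshelve. all: by end_near. Qed.

End Continuation.

Theorem corollary10 (R : realType) (N : nat) (N_gt0 : (0 < N)%N)
    (N_squarefree : squarefree N) (E : R[i] -> R[i] -> R[i])
    (E_cont : eisenstein_continuation N E) (lambda : R)
    (lambda_ge0 : 0 <= lambda) (lambda_lt : lambda < 4^-1) :
  residual_eigenvalue E lambda <-> lambda = 0.
Proof.
split=> [[s [s2 _ -> [z z0 zpole]]]|->].
  have [->|s1] := eqVneq s 1; first by rewrite subrr mulr0.
  by case: (no_pole N_gt0 N_squarefree E_cont z0 s2 s1).
exists 1; split; [lra|by []|by rewrite subrr mulr0|].
have i0 : 0 < complex.Im (0 +i* 1 : R[i]) by rewrite /= ltr01.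
exists (0 +i* 1) => //.
exact: (pole_at_one N_gt0 N_squarefree E_cont i0).
Qed.
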